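(* Let $(\cdot,\cdot)$ be a non-degenerate, ad-invariant, symmetric bilinear form on $\mathfrak g$, and let $r_{\mathfrak g}$ and $r_{\mathfrak g_D}$ be the standard solutions of the modified classical Yang--Baxter equation corresponding to $(\cdot,\cdot)$ and to its restriction to $\mathfrak g_D$ respectively. Then the following holds on $\bigwedge\mathfrak g$: $$[[r_{\mathfrak g}-r_{\mathfrak g_D},\cdot]]=2\delta+\sum_ie(v_i)\cdot\left[\operatorname{ad}(v^i)\cdot(1+2P_+)\right]^{\wedge},$$ where $[[\cdot,\cdot]]$ is the Schouten bracket, $\delta$ is the Chevalley--Eilenberg differential of $\mathfrak g^*$ acting on $\bigwedge\mathfrak g$, $\{v_i\},\{v^i\}$ are bases of $\mathfrak g_D$ dual with respect to $(\cdot,\cdot)$, $e(v)$ is left exterior multiplication by $v$, $P_+:\mathfrak g\to\mathfrak n_D^+$ is the projection corresponding to the decomposition $\mathfrak g=\mathfrak n_D^+\oplus\mathfrak n_D^-\oplus\mathfrak g_D\oplus\mathfrak c_D$, and $T\in\mathfrak{gl}(\mathfrak g)\mapsto T^\wedge\in\mathfrak{gl}(\bigwedge\mathfrak g)$ is the Lie algebra homomorphism given by $$T^\wedge\,X_1\wedge\cdots\wedge X_k=\sum_{i=1}^kX_1\wedge\cdots\wedge TX_i\wedge\cdots\wedge X_k.$$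
   Context: $\mathfrak g$ is a complex semi-simple Lie algebra, $\mathfrak h\subset\mathfrak g$ a Cartan subalgebra, with a choice of simple roots $\alpha_1,\dots,\alpha_n$; $D\subseteq D_{\mathfrak g}$ is a subdiagram of the Dynkin diagram; $\mathfrak g_D$ is the semi-simple subalgebra generated by the root vectors of weight $\pm\alpha_i$, $\alpha_i\in D$; $\mathfrak l_D=\mathfrak g_D+\mathfrak h=\mathfrak g_D\oplus\mathfrak c_D$, with centre $\mathfrak c_D$ spanned by the fundamental coweights $\lambda_j^\vee$ with $\alpha_j\notin D$. $\mathfrak n_D^{\pm}$ is the span of the root vectors of weight $\pm\alpha$, $\alpha$ ranging over the positive roots of $\mathfrak g$ which are not roots of $\mathfrak g_D$. Standard solutions: $r_{\mathfrak g}=\sum_{\alpha>0}\frac{(\alpha,\alpha)}{2}e_\alpha\wedge f_\alpha\in\bigwedge^2\mathfrak g$, the sum being over positive roots of $\mathfrak g$, where $e_\alpha\in\mathfrak g_\alpha$, $f_\alpha\in\mathfrak g_{-\alpha}$ satisfy $[e_\alpha,f_\alpha]=h_\alpha$ (the coroot) and $(\alpha,\alpha)$ is computed with the induced form on $\mathfrak h^*$; $r_{\mathfrak g_D}$ is given by the same formula, summing over the positive roots of $\mathfrak g_D$. Schouten bracket: $$[[X_1\wedge\cdots\wedge X_k,Y_1\wedge\cdots\wedge Y_l]]=\sum_{i,j}(-1)^{i+j}[X_i,Y_j]\wedge X_1\wedge\cdots\wedge\widehat{X_i}\wedge\cdots\wedge X_k\wedge Y_1\wedge\cdots\wedge\widehat{Y_j}\wedge\cdots\wedge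 Y_l.$$ Lie algebra structure on $\mathfrak g^*$: identify $\mathfrak g^*$ and $\mathfrak g$ as vector spaces via $(\cdot,\cdot)$ and endow $\mathfrak g^*$ with the bracket $$[x,y]^*=[x_D,y_D]+[x_D,y_++y_-]+[x_++x_-,y_D]+[x_+,y_+]-[x_-,y_-]+\tfrac12[x_0,y_+-y_-]+\tfrac12[x_+-x_-,y_0],$$ where $z_D\in\mathfrak g_D$, $z_\pm\in\mathfrak n_D^\pm$, $z_0\in\mathfrak c_D$ are the components of $z$. That is, $\mathfrak g^*=(\mathfrak n_D^+\oplus\overline{\mathfrak n}_D^-)\rtimes(\mathfrak g_D\oplus\mathfrak c_D)$, where $\overline{\mathfrak n}_D^-$ is $\mathfrak n_D^-$ with the opposite bracket, $\mathfrak g_D$ acts on $\mathfrak n_D^\pm$ by the adjoint action and $\mathfrak c_D$ acts on $\mathfrak n_D^\pm$ by $\pm\frac12$ times the adjoint action. $\delta\in\operatorname{End}(\bigwedge\mathfrak g)$ is the differential obtained by regarding $\bigwedge\mathfrak g=\bigwedge(\mathfrak g^* )^*$ as the Chevalley--Eilenberg complex of $(\mathfrak g^*,[\cdot,\cdot]^* )$, with the sign convention that $\delta$ is the degree 1 derivation whose restriction $\mathfrak g\to\bigwedge^2\mathfrak g$ is the transpose of $[\cdot,\cdot]^*:\bigwedge^2\mathfrak g\to\mathfrak g$, where $\mathfrak g$ is paired with itself by $(\cdot,\cdot)$ and $\bigwedge^2\mathfrak g$ with itself by $(a\wedge b,c\wedge d)=(a,c)(b,d)-(a,d)(b,c)$.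 *)

(* Defs.v *)
From HB Require Import structures.
From mathcomp Require Import all_boot all_order all_algebra.
From mathcomp Require Import zify.

Set Implicit Arguments.
Unset Strict Implicit.
Unset Printing Implicit Defensive.

Import GRing.Theory.
Local Open Scope ring_scope.

Section LinearFun.
Variables (K : fieldType) (U W : lmodType K) (f : U -> W).
Hypothesis f_lin : linear f.

Lemma linear_funZ a x : f (a *: x) = a *: f x.
Proof. exact: (scalable_linear f_lin). Qed.

Lemma linear_funD x y : f (x + y) = f x + f y.
Proof. by rewrite -[x]scale1r f_lin !scale1r. Qed.

Lemma linear_fun0 : f 0 = 0.
Proof. by rewrite -(scale0r 0) linear_funZ scale0r. Qed.

Lemma linear_fun_sum I (r : seq I) (P : pred I) F :
  f (\sum_(i <- r | P i) F i) = \sum_(i <- r | P i) f (F i).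
Proof. exact: (big_morph f linear_funD linear_fun0). Qed.

End LinearFun.

Section ExteriorAlgebra.
Variables (K : fieldType) (V : vectType K).
Local Notation n := (\dim {:V}).
Local Notation bas := (vbasis {:V}).

Definition extalg := 'rV[K]_#|{set 'I_n}|.
HB.instance Definition _ := Vector.copy extalg 'rV[K]_#|{set 'I_n}|.

Definition ext_coef (x : extalg) (S : {set 'I_n}) : K := x 0 (enum_rank S).

Definition ext_basis (S : {set 'I_n}) : extalg := delta_mx 0 (enum_rank S).

Definition ext_inv (S T : {set 'I_n}) : nat :=
  (\sum_(i in S) \sum_(j in T) (j < i))%N.

Definition ext_bmul (S T : {set 'I_n}) : extalg :=
  if [disjoint S & T] then (-1) ^+ ext_inv S T *: ext_basis (S :|: T) else 0.

Definition ext_mul (x y : extalg) : extalg :=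
  \sum_S \sum_T (ext_coef x S * ext_coef y T) *: ext_bmul S T.

Lemma ext_coef_basis S T : ext_coef (ext_basis S) T = (S == T)%:R.
Proof.
by rewrite /ext_coef mxE eqxx eq_sym (inj_eq enum_rank_inj).
Qed.

Fact ext_coef_linear S : linear_for *%R (ext_coef^~ S).
Proof. by move=> a x y; rewrite /ext_coef !mxE. Qed.

Lemma ext_expand (x : extalg) : x = \sum_S ext_coef x S *: ext_basis S.
Proof.
rewrite {1}[x]row_sum_delta (reindex_onto (@enum_rank _) enum_val) /=; last first.
  by move=> i _; rewrite enum_valK.
by apply: eq_bigl => S; rewrite enum_rankK eqxx.
Qed.

Fact ext_mul_linl y : linear (ext_mul^~ y).
Proof.
move=> a u v; rewrite /ext_mul scaler_sumr -big_split /=; apply: eq_bigr => S _.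
rewrite scaler_sumr -big_split /=; apply: eq_bigr => T _.
by rewrite ext_coef_linear scalerA -scalerDl mulrDl -mulrA.
Qed.

Fact ext_mul_linr x : linear (ext_mul x).
Proof.
move=> a u v; rewrite /ext_mul scaler_sumr -big_split /=; apply: eq_bigr => S _.
rewrite scaler_sumr -big_split /=; apply: eq_bigr => T _.
by rewrite ext_coef_linear scalerA -scalerDl mulrDr mulrCA.
Qed.

Fact ext_mul_suml I (r : seq I) F y :
  ext_mul (\sum_(i <- r) F i) y = \sum_(i <- r) ext_mul (F i) y.
Proof. exact: (linear_fun_sum (ext_mul_linl y)). Qed.

Fact ext_mul_sumr I (r : seq I) F x :
  ext_mul x (\sum_(i <- r) F i) = \sum_(i <- r) ext_mul x (F i).
Proof. exact: (linear_fun_sum (ext_mul_linr x)). Qed.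

Fact ext_mulZl a x y : ext_mul (a *: x) y = a *: ext_mul x y.
Proof. exact: (linear_funZ (ext_mul_linl y)). Qed.

Fact ext_mulZr a x y : ext_mul x (a *: y) = a *: ext_mul x y.
Proof. exact: (linear_funZ (ext_mul_linr x)). Qed.

Fact ext_mul0l y : ext_mul 0 y = 0.
Proof. exact: (linear_fun0 (ext_mul_linl y)). Qed.

Fact ext_mul0r x : ext_mul x 0 = 0.
Proof. exact: (linear_fun0 (ext_mul_linr x)). Qed.

Fact ext_mulDl : left_distributive ext_mul +%R.
Proof. by move=> x y z; exact: (linear_funD (ext_mul_linl z)). Qed.

Fact ext_mulDr : right_distributive ext_mul +%R.
Proof. by move=> x y z; exact: (linear_funD (ext_mul_linr x)). Qed.

Fact ext_mul_basis S T : ext_mul (ext_basis S) (ext_basis T) = ext_bmul S T.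
Proof.
rewrite /ext_mul (bigD1 S) //= (bigD1 T) //= !ext_coef_basis !eqxx mulr1 scale1r.
rewrite big1 ?addr0 => [|T' /negPf hT]; last first.
  by rewrite ext_coef_basis eq_sym hT mulr0 scale0r.
rewrite big1 ?addr0 // => S' /negPf hS; rewrite big1 // => T' _.
by rewrite ext_coef_basis eq_sym hS mul0r scale0r.
Qed.

Lemma ext_invUl (S T U : {set 'I_n}) : [disjoint S & T] ->
  ext_inv (S :|: T) U = (ext_inv S U + ext_inv T U)%N.
Proof. by move=> dST; rewrite /ext_inv -bigU //; apply: eq_bigl => i; rewrite inE. Qed.

Lemma ext_invUr (S T U : {set 'I_n}) : [disjoint T & U] ->
  ext_inv S (T :|: U) = (ext_inv S T + ext_inv S U)%N.
Proof.
move=> dTU; rewrite /ext_inv -big_split /=; apply: eq_bigr => i _.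
by rewrite -bigU //; apply: eq_bigl => j; rewrite inE.
Qed.


Fact ext_mulA_basis S T U :
  ext_mul (ext_basis S) (ext_bmul T U) = ext_mul (ext_bmul S T) (ext_basis U).
Proof.
have dUr (A B C : {set 'I_n}) :
    [disjoint A & B :|: C] = [disjoint A & B] && [disjoint A & C].
  by rewrite -!setI_eq0 setIUr setU_eq0.
have dUl (A B C : {set 'I_n}) :
    [disjoint A :|: B & C] = [disjoint A & C] && [disjoint B & C].
  by rewrite -!setI_eq0 setIUl setU_eq0.
rewrite /ext_bmul; case: ifP => dTU; case: ifP => dST;
  rewrite ?ext_mul0l ?ext_mul0r ?ext_mulZl ?ext_mulZr ?ext_mul_basis
    /ext_bmul ?dUr ?dUl ?dTU ?dST ?andbT ?andbF /= ?scaler0 //.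
case: ifP => dSU; rewrite ?scaler0 // !scalerA -!exprD setUA.
rewrite ext_invUl // ext_invUr //; congr ((-1) ^+ _ *: _); lia.
Qed.
Lemma ext_linear_eq (W : lmodType K) (f g : extalg -> W) :
  linear f -> linear g ->
  (forall S, f (ext_basis S) = g (ext_basis S)) -> f =1 g.
Proof.
move=> lf lg fg x; rewrite [x]ext_expand (linear_fun_sum lf) (linear_fun_sum lg).
by apply: eq_bigr => S _; rewrite (linear_funZ lf) (linear_funZ lg) fg.
Qed.

Fact ext_mulA : associative ext_mul.
Proof.
move=> x y z; apply: (ext_linear_eq (f := fun x => ext_mul x (ext_mul y z))
  (g := fun x => ext_mul (ext_mul x y) z)) x => [|a u v|S]; first exact: ext_mul_linl.
  by rewrite !ext_mul_linl.
apply: (ext_linear_eq (f := fun y => ext_mul (ext_basis S) (ext_mul y z))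
  (g := fun y => ext_mul (ext_mul (ext_basis S) y) z)) y => [a u v|a u v|T].
- by rewrite ext_mul_linl ext_mul_linr.
- by rewrite ext_mul_linr ext_mul_linl.
apply: (ext_linear_eq (f := fun z => ext_mul (ext_basis S) (ext_mul (ext_basis T) z))
  (g := fun z => ext_mul (ext_mul (ext_basis S) (ext_basis T)) z)) z => [a u v||U].
- by rewrite !ext_mul_linr.
- exact: ext_mul_linr.
by rewrite !ext_mul_basis ext_mulA_basis.
Qed.

Fact ext_mul1l : left_id (ext_basis set0) ext_mul.
Proof.
apply: ext_linear_eq => [|a u v|S]; [exact: ext_mul_linr|by []|].
rewrite ext_mul_basis /ext_bmul -setI_eq0 set0I eqxx set0U.
by rewrite /ext_inv big_set0 scale1r.
Qed.
Fact ext_mul1r : right_id (ext_basis set0) ext_mul.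
Proof.
apply: (ext_linear_eq (f := ext_mul^~ (ext_basis set0))) => [|a u v|S].
- exact: ext_mul_linl.
- by [].
rewrite ext_mul_basis /ext_bmul -setI_eq0 setI0 eqxx setU0.
by rewrite /ext_inv big1 ?scale1r // => i _; rewrite big_set0.
Qed.
Fact ext_one_neq0 : ext_basis set0 != 0.
Proof.
apply/eqP => /(congr1 (ext_coef^~ set0)); rewrite ext_coef_basis eqxx.
by rewrite /ext_coef mxE => /eqP; rewrite oner_eq0.
Qed.
HB.instance Definition _ := GRing.Zmodule_isNzRing.Build extalg
  ext_mulA ext_mul1l ext_mul1r ext_mulDl ext_mulDr ext_one_neq0.
HB.instance Definition _ := GRing.Lmodule_isLalgebra.Build K extalg
  (fun a x y => esym (ext_mulZl a x y)).
HB.instance Definition _ := GRing.Lalgebra_isAlgebra.Build K extalg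
  (fun a x y => esym (ext_mulZr a x y)).
End ExteriorAlgebra.

Section ExteriorCalculus.
Variables (K : fieldType) (V : vectType K).
Local Notation n := (\dim {:V}).
Local Notation bas := (vbasis {:V}).
Local Notation L := (extalg V).

Definition ext1 (v : V) : L := \sum_(i < n) coord bas i v *: ext_basis [set i].

Definition wedge (X : seq V) : L := \prod_(x <- X) ext1 x.

Definition ext_seq (S : {set 'I_n}) : seq V := [seq bas`_(i : 'I_n) | i <- enum S].

Definition ext_lin (W : lmodType K) (F : seq V -> W) (x : L) : W :=
  \sum_S ext_coef x S *: F (ext_seq S).

Definition rem_nth (i : nat) (X : seq V) : seq V := take i X ++ drop i.+1 X.

Definition ext_lift (T : V -> V) : L -> L :=
  ext_lin (fun X => \sum_(i < size X)
    wedge (take i X ++ T X`_i :: drop i.+1 X)).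

Definition ext_der (d : V -> L) : L -> L :=
  ext_lin (fun X => \sum_(i < size X)
    (-1) ^+ i *: (wedge (take i X) * d X`_i * wedge (drop i.+1 X))).

Definition ext2_form (B : V -> V -> K) : L -> L -> K^o :=
  fun x y => ext_lin (fun X => ext_lin (fun Y : seq V => (
    if (X, Y) is ([:: a; b], [:: c; d]) then B a c * B b d - B a d * B b c
    else 0) : K^o) y) x.

End ExteriorCalculus.

HB.mixin Record Vector_isLie (K : fieldType) V of Vector K V := {
  lie : V -> V -> V;
  lie_linearl : forall y, linear (fun x => lie x y);
  lie_linearr : forall x, linear (lie x);
  liexx : forall x, lie x x = 0;
  lie_jacobi : forall x y z,
    lie x (lie y z) + lie y (lie z x) + lie z (lie x y) = 0
}.

#[short(type="lieAlgType")]
HB.structure Definition LieAlgebra (K : fieldType) :=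
  {V of Vector K V & Vector_isLie K V}.

Section Lie.
Variables (K : fieldType) (g : lieAlgType K).
Implicit Types (U W : {vspace g}).

Definition ad (x : g) : 'End(g) := linfun (lie x).

Definition lie_prodv U W : {vspace g} :=
  <<[seq lie u w | u <- vbasis U, w <- vbasis W]>>%VS.

Definition lie_ideal U := forall x y : g, y \in U -> lie x y \in U.

Definition lie_subalg U :=
  forall x y : g, x \in U -> y \in U -> lie x y \in U.

Definition lie_solvable U :=
  exists k : nat, iter k (fun W => lie_prodv W W) U = 0%VS.

Definition semisimple := forall U, lie_ideal U -> lie_solvable U -> U = 0%VS.

Definition lie_gen U : {vspace g} :=
  iter (\dim {:g}) (fun W => W + lie_prodv W W)%VS U.

Definition lie_center U : {vspace g} :=
  (U :&: \bigcap_(y <- vbasis U) lker (ad y))%VS.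

Definition ad_diagonalizable (x : g) :=
  exists2 b : (\dim {:g}).-tuple g, basis_of {:g} b &
    forall i, exists c : K, lie x (tnth b i) = c *: tnth b i.

Definition cartan_subalgebra (h : {vspace g}) :=
  [/\ {in h &, forall x y, lie x y = 0},
      forall x, {in h, forall t, lie t x = 0} -> x \in h &
      {in h, forall t, ad_diagonalizable t}].

Definition schouten (x y : extalg g) : extalg g :=
  ext_lin (fun X => ext_lin (fun Y =>
    \sum_(i < size X) \sum_(j < size Y) (-1) ^+ (i + j) *:
      (ext1 (lie X`_i Y`_j) * wedge (rem_nth i X) * wedge (rem_nth j Y))) y) x.

End Lie.
From mathcomp Require Import boolp classical_sets fsbigop reals.
From mathcomp Require Import complex.

Section Roots.
Variables (K : fieldType) (g : lieAlgType K) (h : {vspace g}).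
Implicit Types (U : {vspace g}).

Definition dualv U := 'Hom(subvs_of U, K^o).
HB.instance Definition _ U := Vector.on (dualv U).

Definition root_space (b : dualv h) : {vspace g} :=
  (\bigcap_(t <- vbasis {:subvs_of h}) lker (ad (vsval t) - (b t : K) *: (\1%VF : 'End(g))))%VS.

Definition root_of U : set (dualv h) :=
  [set b | b != 0 /\ (U :&: root_space b)%VS != 0%VS].

Variables (n : nat) (alpha : n.-tuple (dualv h)).

Definition nonneg_comb (b : dualv h) :=
  exists c : 'I_n -> nat, b = \sum_i tnth alpha i *+ c i.

Definition simple_roots :=
  [/\ basis_of fullv alpha,
      forall i, root_of {:g} (tnth alpha i) &
      forall b, root_of {:g} b -> nonneg_comb b \/ nonneg_comb (- b)].

Definition pos_root U : set (dualv h) :=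
  [set b | root_of U b /\ nonneg_comb b].

Variable (D : {set 'I_n}).

Definition sub_g : {vspace g} :=
  lie_gen (\sum_(i in D) (root_space (tnth alpha i) + root_space (- tnth alpha i)))%VS.

Definition sub_l : {vspace g} := (sub_g + h)%VS.

Definition sub_c : {vspace g} := lie_center sub_l.

Definition nil_root : set (dualv h) :=
  [set b | pos_root {:g} b /\ ~ root_of sub_g b].

Definition sub_np : {vspace g} :=
  (\big[addv/0%VS]_(b \in nil_root) root_space b)%VS.

Definition sub_nm : {vspace g} :=
  (\big[addv/0%VS]_(b \in nil_root) root_space (- b))%VS.

Definition proj_np : 'End(g) := daddv_pi sub_np (sub_nm + sub_g + sub_c)%VS.
Definition proj_nm : 'End(g) := daddv_pi sub_nm (sub_np + sub_g + sub_c)%VS.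
Definition proj_g : 'End(g) := daddv_pi sub_g (sub_np + sub_nm + sub_c)%VS.
Definition proj_c : 'End(g) := daddv_pi sub_c (sub_np + sub_nm + sub_g)%VS.

Definition dual_lie (x y : g) : g :=
  let xD := proj_g x in let yD := proj_g y in
  let xp := proj_np x in let yp := proj_np y in
  let xm := proj_nm x in let ym := proj_nm y in
  let x0 := proj_c x in let y0 := proj_c y in
  lie xD yD + lie xD (yp + ym) + lie (xp + xm) yD + lie xp yp - lie xm ym
  + 2^-1 *: lie x0 (yp - ym) + 2^-1 *: lie (xp - xm) y0.

Variable B : {symmetric g}.

Definition form_invariant := forall x y z : g, B (lie x y) z = B x (lie y z).

Definition form_flat U (x : subvs_of U) : dualv U :=
  linfun (fun y : subvs_of U => B (vsval x) (vsval y) : K^o).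

Definition form_sharp U (b : dualv U) : g := vsval ((linfun (@form_flat U))^-1%VF b).

Definition dual_form (b c : dualv h) : K := B (form_sharp b) (form_sharp c).

Definition coroot (b : dualv h) : g := (2 / dual_form b b) *: form_sharp b.

Definition standard_r (P : set (dualv h)) (e f : dualv h -> g) : extalg g :=
  \sum_(b \in P) (dual_form b b / 2) *: (ext1 (e b) * ext1 (f b)).

Definition dual_basis (i : 'I_(\dim {:g})) : g :=
  form_sharp (linfun (fun x : subvs_of {:g} => coord (vbasis {:g}) i (vsval x) : K^o)).

Definition cobracket (br : g -> g -> g) (x : g) : extalg g :=
  \sum_(i < \dim {:g}) \sum_(j < \dim {:g} | (i < j)%N)
    B x (br (vbasis {:g})`_i (vbasis {:g})`_j) *:
      (ext1 (dual_basis i) * ext1 (dual_basis j)).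

Definition ce_diff : extalg g -> extalg g := ext_der (cobracket dual_lie).

End Roots.

(* Main.v *)
From HB Require Import structures.
Require Import Defs.
From mathcomp Require Import all_boot all_order all_algebra.
From mathcomp Require Import boolp classical_sets cardinality fsbigop finmap.
From mathcomp Require Import reals complex.
From mathcomp Require Import ring.
Import GRing.Theory.
Local Open Scope ring_scope.
Set Implicit Arguments.
Unset Strict Implicit.
Unset Printing Implicit Defensive.

(** The Schouten bracket with a bivector, the Chevalley-Eilenberg differential
    and the operators e(v) T^ are all of the form
      X_1 ... X_k |-> sum_i (-1)^i X_1 ... d(X_i) ... X_k
    for a linear map d from g to its second exterior power ([schouten_mul2],
    [ext1_mul_lift]): a bivector is even, so it moves freely past the X_j,
    while a single vector v picks up the sign (-1)^i on its way to X_i.  It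
    therefore suffices to compare the three maps d on a single X in g.

    A bivector is determined by its pairings with y /\ z, and [wedge2_expand]
    turns this into an expansion over the basis dual to the chosen basis of g.
    Write N = P_+ - P_-, and y_D for the component of y in g_D.  As there is
    one pair e_b, f_b for each positive root b, and as root spaces are lines,
    contracting r_g - r_{g_D} with y gives - N y ([sum_nils_np],
    [sum_nils_nm]); contracting sum_i v_i (x) v^i gives y_D
    ([sum_dual_basis]).  Moreover P_- is the adjoint of P_+.  By invariance of
    the form, the theorem becomes the identity
      [y, N z] + [N y, z] = 2 [y, z]^* - (1 + 2 P_-)([y_D, z] + [y, z_D]),
    which is [dual_lie_form].  It is read off on components, using only that
    g_D normalises n_D^+ and n_D^- and commutes with c_D.

    What remains is the structure of g.  The commuting operators ad t, t in h,
    are diagonalised simultaneously ([joint_eigen]).  Invariance makes the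
    spaces of weights b and c orthogonal unless b + c = 0, so nondegeneracy of
    the form replaces the usual independence arguments.  Letting f act on a
    vector killed by e would produce infinitely many weights
    ([primitive_iter]) unless roots are non-isotropic ([root_norm_neq0]) and
    root spaces are lines ([root_space_dim1]).

    The subalgebra g_D enters through its generators and through the
    nondegeneracy of the form on it, which the dual bases v, v' witness.
    Orthogonal projection onto g_D commutes with h; this shows that the roots
    of g_D are stable under b |-> - b, and that h is the sum of h /\ g_D and
    c_D.  The simple roots are used to see that bracketing with a generator
    keeps n_D^+ and n_D^- stable ([nil_shift]). *)

(** * Preliminaries on sums and subspaces *)

Lemma sum_alt_lt (K : zmodType) n (F : 'I_n -> 'I_n -> K) :
  (forall i, F i i = 0) ->
  \sum_i \sum_j F i j = \sum_(i < n) \sum_(j < n | (i < j)%N) (F i j + F j i).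
Proof.
move=> F0.
under [RHS]eq_bigr do rewrite big_split /=.
rewrite big_split /= [X in _ = _ + X](exchange_big_dep predT) //= -big_split /=.
apply: eq_bigr => i _; rewrite (bigID (fun j : 'I_n => (i < j)%N)) /=; congr (_ + _).
rewrite (bigID (fun j : 'I_n => (j < i)%N)) /= [X in _ + X]big1 ?addr0.
  by apply: eq_bigl => j; case: ltngtP.
move=> j; case: ltngtP => // /val_inj -> _; exact: F0.
Qed.

Lemma linfunE (K : fieldType) (U W : vectType K) (f : U -> W) :
  linear f -> linfun f =1 f.
Proof.
move=> lf; pose F : {linear U -> W} := HB.pack f (GRing.isLinear.Build K U W *:%R f lf).
exact: (lfunE F).
Qed.

Lemma vsval_lin (K : fieldType) (V : vectType K) (U : {vspace V}) k (x y : subvs_of U) :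
  vsval (k *: x + y) = k *: vsval x + vsval y.
Proof. by rewrite linearP. Qed.

Lemma seq_choice (T S : eqType) (R : T -> S -> Prop) (X : seq T) :
  (forall x, x \in X -> exists y, R x y) ->
  exists2 Y : seq S, forall x, x \in X -> exists2 y, y \in Y & R x y &
    forall y, y \in Y -> exists2 x, x \in X & R x y.
Proof.
elim: X => [|x X IH] RX; first by exists [::].
have [|Y YX XY] := IH; first by move=> z zX; apply: RX; rewrite inE zX orbT.
have [y Rxy] := RX x (mem_head _ _); exists (y :: Y) => z.
  rewrite inE => /predU1P[->|/YX[w wY Rzw]]; first by exists y; rewrite ?mem_head.
  by exists w; rewrite ?inE ?wY ?orbT.
rewrite inE => /predU1P[->|/XY[w wX Rwz]]; first by exists x; rewrite ?mem_head.
by exists w; rewrite ?inE ?wX ?orbT.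
Qed.

Lemma bigcapv_seqP (K : fieldType) (V : vectType K) (I : eqType) (s : seq I)
    (F : I -> {vspace V}) x :
  reflect (forall i, i \in s -> x \in F i) (x \in \bigcap_(i <- s) F i)%VS.
Proof.
elim: s => [|i s IH]; first by rewrite big_nil memvf; constructor.
rewrite big_cons memv_cap; apply: (iffP andP) => [[xi /IH xs] j|xs].
  by rewrite inE => /predU1P[->|/xs].
split; first by apply: xs; rewrite mem_head.
by apply/IH => j js; apply: xs; rewrite inE js orbT.
Qed.

Lemma daddv_piE (K : fieldType) (V : vectType K) (U W : {vspace V}) u w :
  (U :&: W = 0)%VS -> u \in U -> w \in W -> daddv_pi U W (u + w) = u.
Proof.
move=> UW uU wW; rewrite linearD /= daddv_pi_id //.
have /eqP := daddv_pi_add UW (subvP (addvSr U W) _ wW).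
rewrite [daddv_pi W U w]daddv_pi_id // 1?capvC // -subr_eq0 addrK => /eqP ->.
by rewrite addr0.
Qed.

Lemma fsbig_addv_ind (K : fieldType) (V : vectType K) (I : choiceType) (A : set I)
    (F : I -> {vspace V}) (P : V -> Prop) :
  finite_set A -> (forall k x y, P x -> P y -> P (k *: x + y)) -> P 0 ->
  (forall i x, A i -> x \in F i -> P x) ->
  forall x, x \in (\big[addv/0%VS]_(i \in A) F i)%VS -> P x.
Proof.
move=> finA Pl P0 PF; rewrite fsbig_finite // big_seq.
apply: (big_ind (fun W : {vspace V} => forall x, x \in W -> P x)) => [x|U W PU PW x|i].
- by rewrite memv0 => /eqP ->.
- by case/memv_addP=> u /PU Pu [w /PW Pw ->]; rewrite -[u]scale1r; exact: Pl.
by rewrite in_fset_set // => /set_mem Ai x; exact: PF.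
Qed.

Lemma fsbig_addv_sup (K : fieldType) (V : vectType K) (I : choiceType) (A : set I)
    (F : I -> {vspace V}) i :
  finite_set A -> A i -> (F i <= \big[addv/0%VS]_(j \in A) F j)%VS.
Proof.
move=> finA Ai; rewrite fsbig_finite // (bigD1_seq i) ?fset_uniq //= ?addvSl //.
by rewrite in_fset_set // mem_set.
Qed.

(** * The exterior algebra and operators of degree one *)

Section Exterior.
Variables (K : fieldType) (V : vectType K).
Local Notation n := (\dim {:V}).
Local Notation bas := (vbasis {:V}).
Local Notation L := (extalg V).
Implicit Types (x y : L) (a b c : V).

Lemma ext1_linear : linear (@ext1 K V).
Proof.
move=> k a b; rewrite /ext1 scaler_sumr -big_split /=; apply: eq_bigr => i _.
by rewrite linearP /= scalerDl scalerA.
Qed.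

HB.instance Definition _ := GRing.isLinear.Build K V L *:%R (@ext1 K V) ext1_linear.

Lemma ext1_bas (i : 'I_n) : ext1 bas`_i = ext_basis [set i].
Proof.
rewrite /ext1 (bigD1 i) //= big1 ?addr0 => [|j /negPf ji].
  by rewrite coord_free ?eqxx ?scale1r // (basis_free (vbasisP _)).
by rewrite coord_free ?(basis_free (vbasisP _)) // eq_sym ji scale0r.
Qed.

Lemma ext_basis_anti (i j : 'I_n) :
  ext_basis [set i] * ext_basis [set j] = - (ext_basis [set j] * ext_basis [set i]) :> L.
Proof.
have E (k l : 'I_n) : ext_basis [set k] * ext_basis [set l] =
    if k == l then 0 else (-1) ^+ (l < k)%N *: ext_basis [set k; l] :> L.
  rewrite [LHS]ext_mul_basis /ext_bmul disjoints1 inE; case: eqP => //= kl.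
  by rewrite /ext_inv big_set1 big_set1.
rewrite !E eq_sym; case: eqP => [|/eqP ji]; first by rewrite oppr0.
by rewrite finset.setUC -scaleNr; case: ltngtP ji => [||/val_inj->]; rewrite ?eqxx ?opprK.
Qed.

Lemma ext1_sq a : ext1 a * ext1 a = 0.
Proof.
rewrite {1 2}/ext1 mulr_suml; under eq_bigr do rewrite mulr_sumr.
rewrite sum_alt_lt => [|i].
  rewrite big1 // => i _; rewrite big1 // => j _.
  rewrite -!scalerAl -!scalerAr !scalerA mulrC -scalerDr.
  by rewrite [X in X + _]ext_basis_anti addNr scaler0.
rewrite -!scalerAl -!scalerAr [X in _ *: (_ *: X)]ext_mul_basis /ext_bmul.
by rewrite disjoints1 inE eqxx /= !scaler0.
Qed.

Lemma ext1_anti a b : ext1 a * ext1 b = - (ext1 b * ext1 a).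
Proof.
have := ext1_sq (a + b); rewrite linearD /= mulrDl !mulrDr !ext1_sq addr0 add0r.
by move=> /eqP; rewrite addr_eq0 => /eqP.
Qed.

(** Used both for the basis of V itself and for its dual basis, hence the
    arbitrary family [w]. *)
Lemma alt_expand (W : lmodType K) (G : V -> V -> W) m (w : 'I_m -> V)
    (a' b' : 'I_m -> K) :
  (forall b, linear (G^~ b)) -> (forall a, linear (G a)) -> (forall a, G a a = 0) ->
  G (\sum_i a' i *: w i) (\sum_i b' i *: w i) =
  \sum_(i < m) \sum_(j < m | (i < j)%N) (a' i * b' j - a' j * b' i) *: G (w i) (w j).
Proof.
move=> Gl Gr Gx; rewrite (linear_fun_sum (Gl _)).
have anti c d : G c d = - G d c.
  have := Gx (c + d); rewrite (linear_funD (Gl _)) !(linear_funD (Gr _)) !Gx addr0 add0r.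
  by move=> /eqP; rewrite addr_eq0 => /eqP.
under eq_bigr do rewrite (linear_funZ (Gl _)) (linear_fun_sum (Gr _)) scaler_sumr.
rewrite sum_alt_lt => [|i]; last by rewrite (linear_funZ (Gr _)) Gx !scaler0.
apply: eq_bigr => i _; apply: eq_bigr => j _; rewrite !(linear_funZ (Gr _)) !scalerA.
by rewrite [X in _ + _ *: X]anti scalerN scalerBl.
Qed.

Lemma ext_lin_linear (W : lmodType K) (F : seq V -> W) : linear (ext_lin F).
Proof.
move=> k x y; rewrite /ext_lin scaler_sumr -big_split /=; apply: eq_bigr => S _.
by rewrite ext_coef_linear scalerA -scalerDl.
Qed.

Lemma ext_lin_basis (W : lmodType K) (F : seq V -> W) S :
  ext_lin F (ext_basis S) = F (ext_seq S).
Proof.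
rewrite /ext_lin (bigD1 S) //= ext_coef_basis eqxx scale1r big1 ?addr0 // => T.
by rewrite ext_coef_basis eq_sym => /negPf ->; rewrite scale0r.
Qed.

(** The enumeration of a set of indices is increasing, which fixes the sign
    when a basis bivector is read back as a list of two vectors. *)
Lemma ext_seq2 (i j : 'I_n) : (i < j)%N -> ext_seq [set i; j] = [:: bas`_i; bas`_j].
Proof.
move=> ij; rewrite /ext_seq.
suff -> : enum [set i; j] = [:: i; j] by [].
apply: (inj_map val_inj); apply: (irr_sorted_eq ltn_trans ltnn) => [||k].
- rewrite sorted_map sorted_filter // => [? ? ?|]; first exact: ltn_trans.
  by rewrite -enumT -sorted_map val_enum_ord iota_ltn_sorted.
- by rewrite /= ij.
apply/mapP/mapP => -[l]; first by rewrite mem_enum !inE => ls ->; exists l; rewrite ?inE.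
by rewrite !inE => ls ->; exists l; rewrite // mem_enum !inE.
Qed.

(** [ext_lin] only evaluates [F] on increasing lists of basis vectors; for an
    alternating bilinear [F] this determines it on all pairs. *)
Lemma ext_lin_mul2 (W : lmodType K) (F : seq V -> W) a b :
  (forall b, linear (fun a => F [:: a; b])) -> (forall a, linear (fun b => F [:: a; b])) ->
  (forall a, F [:: a; a] = 0) ->
  ext_lin F (ext1 a * ext1 b) = F [:: a; b].
Proof.
move=> Fl Fr Fx.
rewrite (coord_vbasis (memvf a)) (coord_vbasis (memvf b)).
rewrite (alt_expand (G := fun a b => F [:: a; b])) //.
rewrite (alt_expand (G := fun a b => ext1 a * ext1 b)) => [|{}b|{}a|]; last exact: ext1_sq.
- rewrite (linear_fun_sum (ext_lin_linear F)); apply: eq_bigr => i _.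
  rewrite (linear_fun_sum (ext_lin_linear F)); apply: eq_bigr => j ij.
  rewrite (linear_funZ (ext_lin_linear F)) !ext1_bas; congr (_ *: _).
  rewrite [X in ext_lin _ X]ext_mul_basis /ext_bmul disjoints1 inE neq_ltn ij /=.
  rewrite /ext_inv !big_set1 ltnNge ltnW //= scale1r.
  by rewrite ext_lin_basis ext_seq2.
- by move=> k c d; rewrite linearP mulrDl scalerAl.
- by move=> k c d; rewrite linearP mulrDr scalerAr.
Qed.

Lemma wedge_cat X Y : wedge (X ++ Y) = wedge X * wedge Y :> L.
Proof. by rewrite /wedge big_cat. Qed.

Lemma wedge_cons a X : wedge (a :: X) = ext1 a * wedge X :> L.
Proof. by rewrite /wedge big_cons. Qed.

Lemma ext1_wedge a X : ext1 a * wedge X = (-1) ^+ size X *: (wedge X * ext1 a) :> L.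
Proof.
elim: X => [|b X IH]; first by rewrite /wedge big_nil mulr1 mul1r scale1r.
rewrite wedge_cons mulrA ext1_anti mulNr -[ext1 b * ext1 a * _]mulrA IH.
by rewrite -scalerAr exprS mulN1r scaleNr mulrA.
Qed.

Lemma ext_der_eq (d d' : V -> L) : d =1 d' -> ext_der d =1 ext_der d'.
Proof. by move=> E x; congr (ext_der _ x); apply: boolp.funext. Qed.

Lemma ext_der_sum I (r : seq I) (P : pred I) (c : I -> K) (d : I -> V -> L) x :
  \sum_(i <- r | P i) c i *: ext_der (d i) x =
  ext_der (fun a => \sum_(i <- r | P i) c i *: d i a) x.
Proof.
rewrite /ext_der /ext_lin; under eq_bigr do rewrite scaler_sumr.
rewrite exchange_big; apply: eq_bigr => S _ /=.
under eq_bigr do rewrite scalerA mulrC -scalerA.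
rewrite -scaler_sumr; congr (_ *: _); under [LHS]eq_bigr do rewrite scaler_sumr.
rewrite [LHS]exchange_big; apply: eq_bigr => i _ /=.
rewrite mulr_sumr mulr_suml scaler_sumr; apply: eq_bigr => j _.
by rewrite -scalerAr -scalerAl !scalerA mulrC.
Qed.

Lemma ext_derZ k (d : V -> L) x : k *: ext_der d x = ext_der (fun a => k *: d a) x.
Proof.
have := @ext_der_sum _ [:: tt] xpredT (fun=> k) (fun=> d) x.
by rewrite big_seq1 => ->; apply: ext_der_eq => a; rewrite big_seq1.
Qed.

Lemma ext_derD (d d' : V -> L) x :
  ext_der d x + ext_der d' x = ext_der (fun a => d a + d' a) x.
Proof.
have := @ext_der_sum _ [:: true; false] xpredT (fun=> 1) (fun b : bool => if b then d else d') x.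
rewrite !big_cons big_nil !scale1r addr0 => ->.
by apply: ext_der_eq => a; rewrite !big_cons big_nil !scale1r addr0.
Qed.

(** Moving [a] from the front to the slot that [T] modifies costs exactly the
    sign of [ext_der]. *)
Lemma ext1_mul_lift a (T : V -> V) x :
  ext1 a * ext_lift T x = ext_der (fun b => ext1 a * ext1 (T b)) x.
Proof.
rewrite /ext_lift /ext_der /ext_lin mulr_sumr; apply: eq_bigr => S _.
rewrite -scalerAr; congr (_ *: _); rewrite mulr_sumr; apply: eq_bigr => i _.
by rewrite wedge_cat wedge_cons !mulrA ext1_wedge size_take ltn_ord -!scalerAl.
Qed.

End Exterior.

Section Schouten.
Variables (K : fieldType) (g : lieAlgType K).

(** The two terms for [a] and [b] combine into an even element, which commutes
    with the factors to its left; what is left of the Schouten sign is the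
    Koszul sign of [ext_der]. *)
Lemma schouten_mul2 (a b : g) (x : extalg g) :
  schouten (ext1 a * ext1 b) x =
  ext_der (fun y => ext1 (lie a y) * ext1 b - ext1 (lie b y) * ext1 a) x.
Proof.
have Dl c : linear (fun d : g => ext1 d * c : extalg g).
  by move=> k d d'; rewrite linearP mulrDl scalerAl.
have Dr c : linear (fun d : g => c * ext1 d : extalg g).
  by move=> k d d'; rewrite linearP mulrDr scalerAr.
rewrite /schouten /ext_der.
pose G (p q : g) := fun Y => \sum_(j < size Y)
  (-1) ^+ j *: ((ext1 (lie p Y`_j) * ext1 q - ext1 (lie q Y`_j) * ext1 p)
     * wedge (rem_nth j Y)).
set F := (X in ext_lin X).
have FE p q : F [:: p; q] = ext_lin (G p q) x.
  rewrite /F; congr (ext_lin _ x); apply: boolp.funext => Y /=.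
  rewrite big_ord_recl big_ord1 /= -big_split; apply: eq_bigr => j _ /=.
  rewrite /bump /= add0n !add1n exprS mulN1r scaleNr -scalerBr /wedge /=; congr (_ *: _).
  by rewrite /rem_nth /= !big_cons !big_nil !mulr1 mulrBl.
rewrite ext_lin_mul2 ?FE; first last.
- move=> p; rewrite FE /ext_lin big1 // => S _; rewrite /G big1 ?scaler0 // => j _.
  by rewrite subrr mul0r scaler0.
- move=> p k q q'; rewrite !FE /ext_lin scaler_sumr -big_split; apply: eq_bigr => S _ /=.
  rewrite scalerA mulrC -scalerA -scalerDr; congr (_ *: _); rewrite /G scaler_sumr.
  rewrite -big_split; apply: eq_bigr => j _ /=.
  rewrite scalerA mulrC -scalerA -scalerDr; congr (_ *: _).
  rewrite scalerAl -mulrDl; congr (_ * _); rewrite (lie_linearl _ k q q') !linearP /=.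
  by rewrite mulrDr mulrDl scalerBr opprD -scalerAr -scalerAl addrACA.
- move=> q k p p'; rewrite !FE /ext_lin scaler_sumr -big_split; apply: eq_bigr => S _ /=.
  rewrite scalerA mulrC -scalerA -scalerDr; congr (_ *: _); rewrite /G scaler_sumr.
  rewrite -big_split; apply: eq_bigr => j _ /=.
  rewrite scalerA mulrC -scalerA -scalerDr; congr (_ *: _).
  rewrite scalerAl -mulrDl; congr (_ * _); rewrite (lie_linearl _ k p p') !linearP /=.
  by rewrite mulrDr mulrDl scalerBr opprD -scalerAr -scalerAl addrACA.
rewrite /ext_lin; apply: eq_bigr => S _; congr (_ *: _); apply: eq_bigr => j _.
congr (_ *: _); rewrite /rem_nth wedge_cat mulrA; congr (_ * _).
rewrite mulrBl mulrBr; congr (_ - _); rewrite -!mulrA !ext1_wedge -!scalerAr !mulrA;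
  rewrite ext1_wedge -!scalerAl scalerA -expr2 sqrr_sign scale1r -!mulrA //.
Qed.

Lemma schouten_linearl (x : extalg g) : linear (fun r => schouten r x).
Proof. exact: ext_lin_linear. Qed.

End Schouten.

(** * Symmetric forms *)

Section Form.
Variables (K : fieldType) (V : vectType K) (B : {symmetric V}).
Implicit Types (x y : V) (U W : {vspace V}).

Lemma symC x y : B x y = B y x.
Proof. by rewrite hermC expr0 mul1r. Qed.

Lemma form_linearl y : linear (fun x => B x y : K^o).
Proof. by move=> k x z; rewrite linearPl. Qed.

Lemma form_linearr x : linear (fun y => B x y : K^o).
Proof. by move=> k y z; rewrite ![B x _]symC form_linearl. Qed.

Definition symDr x := linear_funD (form_linearr x).
Definition symZr x a y : B x (a *: y) = a * B x y := linear_funZ (form_linearr x) a y.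
Definition symDl y x x' : B (x + x') y = B x y + B x' y :=
  linear_funD (form_linearl y) x x'.
Definition symZl y a x : B (a *: x) y = a * B x y := linear_funZ (form_linearl y) a x.

Lemma sym0l y : B 0 y = 0.
Proof. exact: linear_fun0 (form_linearl y). Qed.

Lemma sym0r x : B x 0 = 0.
Proof. exact: linear_fun0 (form_linearr x). Qed.

Lemma symNl x y : B (- x) y = - B x y.
Proof. by rewrite -scaleN1r symZl mulN1r. Qed.

Lemma symNr x y : B x (- y) = - B x y.
Proof. by rewrite -scaleN1r symZr mulN1r. Qed.

Hypothesis B_nondeg : nondegenerate (theta := idfun) B.

Lemma form_eq0 x : (forall y, B x y = 0) -> x = 0.
Proof.
move=> Bx; move/eqP: B_nondeg => B0; apply/eqP; rewrite -memv0 -B0.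
apply/mem_orthovP => y _; exact: Bx.
Qed.

Lemma form_inj x x' : (forall y, B x y = B x' y) -> x = x'.
Proof.
move=> E; apply/eqP; rewrite -subr_eq0; apply/eqP/form_eq0 => y.
by rewrite symDl -scaleN1r symZl E mulN1r subrr.
Qed.

End Form.

Lemma coord_dual_basis (K : fieldType) (V : vectType K) (B : {symmetric V})
    (U : {vspace V}) r (v v' : r.-tuple V) i y :
  basis_of U v' -> (forall i j, B (tnth v i) (tnth v' j) = (i == j)%:R) ->
  y \in U -> coord v' i y = B (tnth v i) y.
Proof.
move=> v'b vv' yU; rewrite [in RHS](coord_basis v'b yU).
rewrite (linear_fun_sum (form_linearr _ _)) (bigD1 i) //=.
rewrite symZr -tnth_nth vv' eqxx mulr1 big1 ?addr0 // => j ji.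
by rewrite symZr -tnth_nth vv' eq_sym (negPf ji) mulr0.
Qed.

Section Sharp.
Variables (K : fieldType) (g : lieAlgType K) (B : {symmetric g}) (U : {vspace g}).
Hypothesis U_nondeg : forall x, x \in U -> (forall y, y \in U -> B x y = 0) -> x = 0.

Lemma form_sharp_mem (b : dualv U) : form_sharp B b \in U.
Proof. exact: subvsP. Qed.

(** Nondegeneracy on [U] makes the flat map injective from U to its dual, hence
    bijective by dimension; so the generic one-sided inverse in [form_sharp] is
    the true inverse. *)
Lemma form_sharpE (b : dualv U) y : y \in U ->
  B (form_sharp B b) y = b (vsproj U y).
Proof.
move=> yU.
have flatE (u v : subvs_of U) : form_flat B u v = B (vsval u) (vsval v) :> K.
  rewrite /form_flat linfunE //= => k w w'.
  by rewrite vsval_lin form_linearr.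
have lin_flat : linear (@form_flat _ _ B U).
  move=> k u u'; apply/lfunP => v; rewrite add_lfunE scale_lfunE !flatE.
  by rewrite vsval_lin symDl symZl.
have ker0 : lker (linfun (@form_flat _ _ B U)) == 0%VS.
  apply/eqP/vspaceP => u; rewrite memv_ker memv0 linfunE //; apply/eqP/eqP => [u0|->].
    apply/val_inj/U_nondeg => [|z zU]; first exact: subvsP.
    by have := flatE u (vsproj U z); rewrite u0 vsprojK // zero_lfunE => <-.
  exact: linear_fun0 lin_flat.
have img : limg (linfun (@form_flat _ _ B U)) = fullv.
  apply/eqP; rewrite eqEdim subvf /= limg_dim_eq; last first.
    by rewrite (eqP ker0) capv0.
  by rewrite !dimvf /dim /= muln1.
rewrite -[in RHS](limg_lfunVK (f := linfun (@form_flat _ _ B U)) (x := b)) ?img ?memvf //.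
by rewrite linfunE // flatE vsprojK.
Qed.

End Sharp.

(** * Brackets and generated subalgebras *)

Section LieBasics.
Variables (K : fieldType) (g : lieAlgType K).
Implicit Types (x y z : g) (U W T : {vspace g}).

Definition lieDl y := linear_funD (@lie_linearl K g y).
Definition lieZl y := linear_funZ (@lie_linearl K g y).
Definition lieDr x := linear_funD (@lie_linearr K g x).
Definition lieZr x := linear_funZ (@lie_linearr K g x).
Definition lie0r x := linear_fun0 (@lie_linearr K g x).
Definition lie0l y := linear_fun0 (@lie_linearl K g y).

Lemma lieC x y : lie x y = - lie y x.
Proof.
have := liexx (x + y); rewrite lieDl !lieDr !liexx addr0 add0r.
by move/eqP; rewrite addr_eq0 => /eqP.
Qed.

Lemma lieNl x y : lie (- x) y = - lie x y.
Proof. by rewrite -scaleN1r lieZl scaleN1r. Qed.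

Lemma lieNr x y : lie x (- y) = - lie x y.
Proof. by rewrite -scaleN1r lieZr scaleN1r. Qed.

Lemma lie_lie x y z : lie x (lie y z) = lie (lie x y) z + lie y (lie x z).
Proof.
have /eqP := lie_jacobi x y z; rewrite -addrA addr_eq0 => /eqP ->.
by rewrite opprD [lie z x]lieC lieNr opprK [lie z _]lieC opprK addrC.
Qed.

Lemma adE x y : ad x y = lie x y.
Proof. exact: linfunE (lie_linearr x) y. Qed.

Lemma lie_prodv_sub U W T :
  (forall x y, x \in U -> y \in W -> lie x y \in T) -> (lie_prodv U W <= T)%VS.
Proof.
move=> UWT; apply/span_subvP => _ /allpairsP[[x y] [xU yW ->]].
by apply: UWT; apply: vbasis_mem.
Qed.

Lemma mem_lie_prodv U W x y : x \in U -> y \in W -> lie x y \in lie_prodv U W.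
Proof.
move=> xU yW; rewrite (coord_vbasis xU) (coord_vbasis yW).
rewrite (linear_fun_sum (lie_linearl _)) memv_suml // => i _.
rewrite lieZl memvZ // (linear_fun_sum (lie_linearr _)) memv_suml // => j _.
rewrite lieZr memvZ // memv_span //; apply/allpairsP.
by exists ((vbasis U)`_i, (vbasis W)`_j); rewrite !mem_nth ?size_tuple.
Qed.

Let step (W : {vspace g}) := (W + lie_prodv W W)%VS.

(** [lie_gen] iterates a fixed number of times, so the induction runs on the
    number of steps; the bracket case may assume that both arguments lie in the
    whole generated subalgebra. *)
Lemma lie_gen_ind (P : g -> Prop) U :
  (forall k x y, P x -> P y -> P (k *: x + y)) ->
  (forall x, x \in U -> P x) ->
  (forall x y, x \in lie_gen U -> y \in lie_gen U -> P x -> P y -> P (lie x y)) ->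
  forall x, x \in lie_gen U -> P x.
Proof.
move=> Plin PU Plie; rewrite /lie_gen.
have mono k l : (k <= l)%N -> (iter k step U <= iter l step U)%VS.
  move=> /subnK <-; elim: (l - k)%N => //= j IH.
  by apply: (subv_trans IH); rewrite addvSl.
have P0 : P 0.
  by have := PU _ (mem0v U).
suff H k : (k <= \dim {:g})%N -> forall x, x \in iter k step U -> P x by apply: (H _ (leqnn _)).
elim: k => [_|k IH lek] //= x /memv_addP[u uk [w wk ->]].
rewrite -[u]scale1r; apply: (Plin); first exact: IH (ltnW lek) _ uk.
move: wk; rewrite /lie_prodv; set X := [seq _ | u0 <- _, w0 <- _] => wk.
rewrite (coord_span (X := in_tuple X) wk).
elim/big_rec: _ => // i y _ Py; apply: (Plin) => //.
have /allpairsP[[a b] /= [ak bk ->]] : X`_i \in X by rewrite mem_nth.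
move/vbasis_mem: ak => ak; move/vbasis_mem: bk => bk.
apply: (Plie); [| |exact: IH (ltnW lek) _ ak|exact: IH (ltnW lek) _ bk].
  exact: (subvP (mono _ _ (ltnW lek))).
exact: (subvP (mono _ _ (ltnW lek))).
Qed.

Lemma sub_lie_gen U : (U <= lie_gen U)%VS.
Proof.
rewrite /lie_gen; elim: (\dim _) => //= j IH; apply: (subv_trans IH); exact: addvSl.
Qed.

(** An increasing chain of subspaces that has not yet stabilised grows by at
    least one dimension at each step, so dim g steps are enough to reach a
    subspace closed under the bracket. *)
Lemma lie_gen_lie U x y : x \in lie_gen U -> y \in lie_gen U -> lie x y \in lie_gen U.
Proof.
pose I k := iter k step U.
have stab k : step (I k) = I k \/ (k <= \dim (I k))%N.
  elim: k => [|k [IH|IH]]; [by right|by left; rewrite /I iterS -/(I k) !IH|].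
  have := addvSl (I k) (lie_prodv (I k) (I k)); rewrite -/(step (I k)) => le.
  case: (eqVneq (I k) (step (I k))) => [E|ne].
    by left; rewrite [I _]iterS -/(I k) -!E.
  right; apply: (leq_ltn_trans IH); rewrite ltn_neqAle dimvS // andbT.
  by apply: contra_neq ne => E; apply/eqP; rewrite eqEdim le E /=.
have st : step (lie_gen U) = lie_gen U.
  rewrite -[lie_gen U]/(I (\dim {:g})); case: (stab (\dim {:g})) => // le.
  have full : I (\dim {:g}) = fullv by apply/eqP; rewrite eqEdim subvf.
  by apply/eqP; rewrite full eqEsubv subvf addvSl.
move=> xU yU; rewrite -st; apply: (subvP (addvSr _ _)); exact: mem_lie_prodv.
Qed.

End LieBasics.

(** * Coordinates of bivectors *)

Section Bivectors.
Variables (K : fieldType) (g : lieAlgType K) (B : {symmetric g}).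
Hypothesis B_nondeg : nondegenerate (theta := idfun) B.

Local Notation bas := (vbasis {:g}).
Local Notation N := (\dim {:g}).

Let fullv_nondeg x : x \in {:g}%VS -> (forall y, y \in {:g}%VS -> B x y = 0) -> x = 0.
Proof. by move=> _ Bx; apply: (form_eq0 B_nondeg) => y; apply: Bx; rewrite memvf. Qed.

Lemma dual_basisE (i : 'I_N) y : B (dual_basis B i) y = coord bas i y.
Proof.
rewrite /dual_basis (form_sharpE fullv_nondeg) ?memvf // linfunE ?vsprojK ?memvf //.
by move=> k x z; rewrite vsval_lin linearP.
Qed.

Lemma dual_basis_expand x : x = \sum_(i < N) B x bas`_i *: dual_basis B i.
Proof.
apply: (form_inj B_nondeg) => y; rewrite (linear_fun_sum (form_linearl _ _)).
rewrite {1}(coord_vbasis (memvf y)) (linear_fun_sum (form_linearr _ _)).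
by apply: eq_bigr => i _; rewrite symZl symZr dual_basisE mulrC.
Qed.

(** The bivector whose pairing with y /\ z is [c y z], for alternating [c];
    [cobracket] is by definition of this form. *)
Definition bivector (c : g -> g -> K) : extalg g :=
  \sum_(i < N) \sum_(j < N | (i < j)%N) c bas`_i bas`_j *:
    (ext1 (dual_basis B i) * ext1 (dual_basis B j)).

Lemma bivector_eq (q q' : g -> g -> K) :
  (forall y z, q y z = q' y z) -> bivector q = bivector q'.
Proof. by move=> E; apply: eq_bigr => i _; apply: eq_bigr => j _; rewrite E. Qed.

Lemma bivector_sum I (s : seq I) (k : I -> K) (c : I -> g -> g -> K) :
  \sum_(i <- s) k i *: bivector (c i) =
  bivector (fun y z => \sum_(i <- s) k i * c i y z).
Proof.
rewrite /bivector; under eq_bigr do rewrite scaler_sumr.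
rewrite exchange_big; apply: eq_bigr => i _ /=.
under eq_bigr do rewrite scaler_sumr.
rewrite exchange_big; apply: eq_bigr => j _ /=.
by rewrite scaler_suml; apply: eq_bigr => a _; rewrite scalerA.
Qed.

Lemma bivectorD k (q q' : g -> g -> K) :
  k *: bivector q + bivector q' = bivector (fun y z => k * q y z + q' y z).
Proof.
have := bivector_sum [:: true; false] (fun b : bool => if b then k else 1)
  (fun b : bool => if b then q else q').
rewrite !big_cons big_nil addr0 scale1r => ->; apply: bivector_eq => y z.
by rewrite !big_cons big_nil addr0 mul1r.
Qed.

Lemma wedge2_expand x y :
  ext1 x * ext1 y = bivector (fun a a1 => B x a * B y a1 - B x a1 * B y a).
Proof.
rewrite {1}[x]dual_basis_expand {1}[y]dual_basis_expand.
rewrite (alt_expand (G := fun a a1 : g => ext1 a * ext1 a1 : extalg g)) //.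
- by move=> u a x1 x2; rewrite linearP mulrDl scalerAl.
- by move=> u a x1 x2; rewrite linearP mulrDr scalerAr.
exact: ext1_sq.
Qed.

End Bivectors.

(** * Simultaneous diagonalisation *)

Section Cartan.
Variables (K : fieldType) (g : lieAlgType K).
Implicit Types (x y z t : g).

(** An eigenvector decomposition inside a subspace [W] stable under ad t, with
    no appeal to polynomials in ad t: peel off one eigenvalue at a time.  If
    [F] is the product of the factors for the remaining eigenvalues, then [F x]
    is an eigenvector for the first one, and subtracting the right multiple of
    it from [x] leaves a vector killed by [F]. *)
Lemma eigen_split t (W : g -> Prop) (s : seq K) x :
  uniq s -> (forall k y z, W y -> W z -> W (k *: y + z)) ->
  (forall y, W y -> W (lie t y)) -> W x ->
  foldr (fun c y => lie t y - c *: y) x s = 0 ->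
  exists2 X : seq g, x \in <<X>>%VS &
    forall y, y \in X -> W y /\ exists c, lie t y = c *: y.
Proof.
move=> us Wl Wt; elim: s us x => [|c s IH] /= us x Wx.
  by move=> ->; exists [::]; rewrite // mem0v.
case/andP: us => cs us.
set A := fun c y => _; pose F y := foldr A y s.
have AW k y : W y -> W (A k y).
  by move=> Wy; rewrite /A -scaleNr addrC; apply: (Wl) => //; exact: Wt.
have FW y : W y -> W (F y).
  by move=> Wy; rewrite /F; elim: (s) => //= k r; exact: AW.
have Flin k y z : F (k *: y + z) = k *: F y + F z.
  rewrite /F; elim: (s) => //= j r ->; rewrite /A lieDr lieZr scalerDr opprD.
  by rewrite addrACA scalerBr !scalerA [k * j]mulrC.
rewrite -/(F x) => /eqP; rewrite subr_eq0 => /eqP xc.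
(* F acts on the eigenvector F x by the scalar p, nonzero as c is not in s *)
pose p := \prod_(k <- s) (c - k).
have Fx : F (F x) = p *: F x.
  rewrite {1}/F /p; elim: (s) => [|k r IHr] /=; first by rewrite big_nil scale1r.
  by rewrite IHr big_cons /A lieZr xc !scalerA -scalerBl mulrBl [c * _]mulrC.
have p0 : p != 0.
  rewrite /p prodf_seq_neq0; apply/allP => k ks /=; rewrite subr_eq0.
  by apply: contraNneq cs => ->.
have xE : x = p^-1 *: F x + (- p^-1 *: F x + x).
  by rewrite addrA -scalerDl subrr scale0r add0r.
have [||X xX WX] := IH us (- p^-1 *: F x + x).
- by apply: (Wl) => //; exact: FW.
- by rewrite -/(F _) Flin Fx scalerA mulNr mulVf // scaleN1r addNr.
exists (F x :: X) => [|y]; last first.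
  by rewrite inE => /predU1P[->|/WX//]; split; [exact: FW|by exists c].
by rewrite [X in X \in _]xE span_cons memv_add ?memvZ ?memv_line //.
Qed.

Lemma ad_diag_annihilated t : ad_diagonalizable t ->
  exists2 s : seq K, uniq s & forall x, foldr (fun c y => lie t y - c *: y) x s = 0.
Proof.
case=> b bb /fin_all_exists[c cE].
exists (undup (codom c)); first exact: undup_uniq.
move=> x; set A := fun c y => _; set s := undup _; pose F y := foldr A y s.
have Flin : linear F.
  move=> k y z; rewrite /F; elim: (s) => //= j r ->.
  rewrite /A lieDr lieZr scalerDr opprD.
  by rewrite addrACA scalerBr !scalerA [k * j]mulrC.
rewrite -/(F x) (coord_basis bb (memvf x)) (linear_fun_sum Flin) big1 // => i _.
rewrite (linear_funZ Flin) -tnth_nth.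
have -> : F (tnth b i) = (\prod_(k <- s) (c i - k)) *: tnth b i.
  rewrite /F; elim: (s) => [|k r IHr] /=; first by rewrite big_nil scale1r.
  by rewrite IHr big_cons /A lieZr cE !scalerA -scalerBl mulrBl [c i * _]mulrC.
rewrite (_ : \prod_(k <- s) _ = 0) ?scale0r ?scaler0 //.
apply/eqP; rewrite prodf_seq_eq0; apply/hasP; exists (c i); rewrite ?subrr //=.
by rewrite mem_undup codom_f.
Qed.

(** Each common eigenvector for [ts] is split further under [t] inside the
    space [W] of vectors with the same eigenvalues for [ts], which is stable
    under ad t as [t] commutes with [ts]. *)
Lemma joint_eigen (ts : seq g) :
  {in ts &, forall x y, lie x y = 0} -> {in ts, forall t, ad_diagonalizable t} ->
  exists2 X : seq g, <<X>>%VS = fullv &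
    forall y t, y \in X -> t \in ts -> exists c, lie t y = c *: y.
Proof.
elim: ts => [|t ts IH] tC tD.
  by exists (vbasis {:g}) => //; exact: span_basis (vbasisP _).
have [||X Xf Xe] := IH.
- by move=> u w us ws; apply: tC; rewrite inE ?us ?ws orbT.
- by move=> u us; apply: tD; rewrite inE us orbT.
have [s us s0] := ad_diag_annihilated (tD t (mem_head _ _)).
pose R y (Y : seq g) := y \in <<Y>>%VS /\
  forall z u, z \in Y -> u \in t :: ts -> exists c, lie u z = c *: z.
have [y yX|Y YX XY] := @seq_choice _ _ R X.
  (* z has every eigenvalue that y has *)
  pose W z := forall u c, u \in ts -> lie u y = c *: y -> lie u z = c *: z.
  have [|||Y yY WY] := @eigen_split t W s y us _ _ _ (s0 y).
  - move=> k z w Wz Ww u c uts uy.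
    by rewrite lieDr lieZr (Wz _ _ uts uy) (Ww _ _ uts uy) scalerDr !scalerA mulrC.
  - move=> z Wz u c uts uy; rewrite lie_lie (tC u t) ?mem_head ?inE ?uts ?orbT //.
    by rewrite lie0l add0r (Wz _ _ uts uy) lieZr.
  - by move=> u c _.
  exists Y; split=> // z u zY; have [Wz tz] := WY z zY.
  rewrite inE => /predU1P[->//|uts]; have [c uc] := Xe y u yX uts.
  by exists c; apply: Wz.
exists (flatten Y) => [|y u /flattenP[Z ZY yZ] uts].
  apply/eqP; rewrite eqEsubv subvf -Xf; apply/span_subvP => y /YX[Z ZY [yZ _]].
  apply: (subvP _ _ yZ); apply: sub_span => z zZ; apply/flattenP; by exists Z.
by have [x xX [_ RZ]] := XY Z ZY; exact: RZ.
Qed.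

End Cartan.

(** * Weights of a Cartan subalgebra *)

Section Weights.
Variables (K : fieldType) (g : lieAlgType K) (h : {vspace g}) (B : {symmetric g}).
Implicit Types (x y z t : g) (b c : dualv h).

(** The value of a weight at a vector of g; weights live on the subtype of h,
    so this is meaningful for [t] in [h] only. *)
Definition wt b t : K := b (vsproj h t).

Lemma root_spaceP b x :
  reflect (forall t, t \in h -> lie t x = wt b t *: x) (x \in root_space b).
Proof.
have kerE (t : subvs_of h) : (x \in lker (ad (vsval t) - (b t : K) *: (\1%VF : 'End(g)))%VF) =
    (lie (vsval t) x == wt b (vsval t) *: x).
  rewrite memv_ker add_lfunE opp_lfunE scale_lfunE id_lfunE adE subr_eq0.
  by rewrite /wt vsvalK.
apply: (iffP (bigcapv_seqP _ _ _)) => [H t th|H t _]; last first.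
  by rewrite kerE H // subvsP.
rewrite /wt -{1}(vsprojK th); move: (vsproj h t) => u.
rewrite (coord_vbasis (memvf u)) !linear_sum /=.
rewrite (linear_fun_sum (@lie_linearl _ _ _)) scaler_suml; apply: eq_bigr => i _.
rewrite !linearZ /= lieZl; have := H (vbasis {:subvs_of h})`_i.
rewrite mem_nth ?size_tuple // kerE => /(_ isT)/eqP ->.
by rewrite /wt vsvalK scalerA.
Qed.

Lemma wtD b c t : wt (b + c) t = wt b t + wt c t.
Proof. by rewrite /wt add_lfunE. Qed.

Lemma wtN b t : wt (- b) t = - wt b t.
Proof. by rewrite /wt opp_lfunE. Qed.

Lemma wt0 t : wt 0 t = 0.
Proof. by rewrite /wt zero_lfunE. Qed.

Lemma wt_inj b c : {in h, wt b =1 wt c} -> b = c.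
Proof. by move=> E; apply/lfunP => t; rewrite -[t]vsvalK; apply: E; exact: subvsP. Qed.

Lemma root_space_lie b c x y :
  x \in root_space b -> y \in root_space c -> lie x y \in root_space (b + c).
Proof.
move=> /root_spaceP bx /root_spaceP cy; apply/root_spaceP => t th.
by rewrite lie_lie (bx t th) (cy t th) lieZl lieZr -scalerDl wtD.
Qed.

Hypothesis h_cartan : cartan_subalgebra h.

Lemma root_space0 : root_space (0 : dualv h) = h.
Proof.
have [hC hcent _] := h_cartan; apply/vspaceP => x.
apply/root_spaceP/idP => [x0|xh t th]; last by rewrite wt0 scale0r hC.
by apply: hcent => t th; rewrite x0 // wt0 scale0r.
Qed.

(** A common eigenvector [x] of h has as weight the functional that sends [t]
    to a fixed nonzero coordinate of [lie t x], divided by that of [x]. *)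
Lemma weight_span : exists2 X : seq g, <<X>>%VS = fullv &
  forall x, x \in X -> exists b : dualv h, x \in root_space b.
Proof.
have [hC hcent hD] := h_cartan.
have [t u tX uX|t tX|X Xf Xe] := @joint_eigen _ _ (vbasis h).
- by apply: hC; apply: vbasis_mem.
- by apply: hD; apply: vbasis_mem.
exists X => // x xX.
case: (eqVneq x 0) => [->|x0]; first by exists 0; rewrite mem0v.
have [i xi] : exists i, coord (vbasis {:g}) i x != 0.
  apply/existsP; rewrite -negb_forall; apply: contra x0 => /forallP x0.
  by rewrite (coord_vbasis (memvf x)) big1 // => i _; rewrite (eqP (x0 i)) scale0r.
set k := coord _ i x in xi.
pose F (t : subvs_of h) : K^o := k^-1 * coord (vbasis {:g}) i (lie (vsval t) x).
have Flin : linear F.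
  by move=> a t u; rewrite /F linearP /= lieDl lieZl linearP /= mulrDr mulrCA.
exists (linfun F); apply/root_spaceP => t th.
have [c tx] : exists a : K, lie t x = a *: x.
  rewrite (coord_vbasis th) (linear_fun_sum (@lie_linearl _ _ _)).
  apply: (big_ind (fun y => exists a : K, y = a *: x)) => [|y z [c ->] [d ->]|j _].
  - by exists 0; rewrite scale0r.
  - by exists (c + d); rewrite scalerDl.
  have [|c cE] := Xe x (vbasis h)`_j xX; first by rewrite mem_nth ?size_tuple.
  by rewrite lieZl cE scalerA; eexists.
rewrite /wt linfunE // /F vsprojK // tx linearZ /= mulrC -mulrA mulfV // mulr1.
by [].
Qed.

Lemma weight_ind (P : g -> Prop) :
  (forall k x y, P x -> P y -> P (k *: x + y)) ->
  (forall b x, x \in root_space b -> P x) -> forall x, P x.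
Proof.
move=> Pl Pw x; have [X Xf Xw] := weight_span.
have: x \in <<in_tuple X>>%VS by rewrite Xf memvf.
move=> /coord_span ->; elim/big_rec: _ => [|i y _ Py]; first exact: Pw 0 _ (mem0v _).
apply: (Pl) => //; have [|b] := Xw (in_tuple X)`_i; last exact: Pw.
by rewrite mem_nth.
Qed.

Hypothesis B_inv : form_invariant B.

Lemma form_ad t x y : B (lie t x) y = - B x (lie t y).
Proof. by rewrite lieC symNl B_inv. Qed.

Lemma form_root_space b c x y : b + c != 0 ->
  x \in root_space b -> y \in root_space c -> B x y = 0.
Proof.
move=> bc /root_spaceP bx /root_spaceP cy; apply: contraNeq bc => Bxy.
apply/eqP/wt_inj => t th; rewrite wtD wt0.
have := form_ad t x y; rewrite bx // cy // symZl symZr => /eqP.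
by rewrite -addr_eq0 -mulrDl mulf_eq0 (negPf Bxy) orbF => /eqP.
Qed.

Hypothesis B_nondeg : nondegenerate (theta := idfun) B.

(** Pairing with [x] must be nonzero on some weight space, and orthogonality
    leaves only the opposite one. *)
Lemma root_space_dual b x : x \in root_space b -> x != 0 ->
  exists2 y, y \in root_space (- b) & B x y != 0.
Proof.
move=> bx x0; apply: contrapT => N; case/eqP: x0; apply: (form_eq0 B_nondeg).
apply: weight_ind => [k y z By Bz|c y cy].
  by rewrite symDr symZr By Bz mulr0 addr0.
case: (eqVneq (b + c) 0) => [bc|bc]; last exact: form_root_space bc bx cy.
apply: contrapT => /eqP Bxy; apply: N; exists y => //.
by rewrite -[- b]addr0 -bc addKr.
Qed.

(** A nonzero vector of weight [b] pairs nontrivially with a member of a finite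
    spanning set of weight vectors, whose weight is then [- b]. *)
Lemma weights_finite : exists s : seq (dualv h),
  forall b x, x \in root_space b -> x != 0 -> b \in s.
Proof.
have [X Xf Xw] := weight_span.
have [s sX _] := seq_choice Xw; exists [seq - b | b <- s] => b x bx x0.
have [y yX Bxy] : exists2 y, y \in X & B x y != 0.
  apply: contrapT => N; case/eqP: x0; apply: (form_eq0 B_nondeg) => y.
  have: y \in <<in_tuple X>>%VS by rewrite Xf memvf.
  move=> /coord_span ->; rewrite (linear_fun_sum (form_linearr _ _)) big1 // => i _.
  rewrite symZr; suff -> : B x (in_tuple X)`_i = 0 by rewrite mulr0.
  by apply: contrapT => /eqP ?; apply: N; exists (in_tuple X)`_i; rewrite ?mem_nth.
have [c cs cy] := sX y yX; apply/mapP; exists c => //.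
apply/eqP; rewrite -addr_eq0; apply: contraNT Bxy => bc.
by apply/eqP; exact: form_root_space bc bx cy.
Qed.

Lemma cartan_nondeg x : x \in h -> (forall y, y \in h -> B x y = 0) -> x = 0.
Proof.
rewrite -{1}root_space0 => x0 Bx; apply: (form_eq0 B_nondeg).
apply: weight_ind => [k y z By Bz|c y cy].
  by rewrite symDr symZr By Bz mulr0 addr0.
case: (eqVneq c 0) => [c0|c0]; first by apply: Bx; rewrite -root_space0 -c0.
by apply: form_root_space x0 cy; rewrite add0r.
Qed.

Lemma sharp_mem b : form_sharp B b \in h.
Proof. exact: form_sharp_mem. Qed.

Lemma sharpE b t : t \in h -> B (form_sharp B b) t = wt b t.
Proof. exact: form_sharpE cartan_nondeg b t. Qed.

Lemma dual_formE b c : dual_form B b c = wt b (form_sharp B c).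
Proof. by rewrite -sharpE ?sharp_mem. Qed.

(** Both sides lie in [h], where the form is nondegenerate, and invariance
    gives the same pairing with every [t] in [h]. *)
Lemma lie_opp_roots b x y : x \in root_space b -> y \in root_space (- b) ->
  lie x y = B x y *: form_sharp B b.
Proof.
move=> bx by_; have xyh : lie x y \in h.
  by rewrite -root_space0 -(subrr b); apply: root_space_lie.
apply/eqP; rewrite -subr_eq0; apply/eqP/cartan_nondeg => [|t th].
  by rewrite memvB ?memvZ ?sharp_mem.
rewrite -scaleN1r symDl !symZl sharpE // symC -B_inv.
by rewrite (root_spaceP _ _ bx) // symZl mulrC mulN1r subrr.
Qed.

Hypothesis charK : forall n, n.+1%:R != 0 :> K.

(** The weights along the string are pairwise distinct in characteristic zero,
    and there are finitely many of them. *)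
Lemma root_string_finite b c f y : b != 0 -> f \in root_space b ->
  y \in root_space c -> exists n, iter n (lie f) y = 0.
Proof.
move=> b0 fb yc; apply: contrapT => /forallNP N.
have [s sP] := weights_finite.
have mem n : c + b *+ n \in s.
  apply: (sP _ (iter n (lie f) y)); last exact/eqP/N.
  elim: n => [|n IH] /=; first by rewrite addr0.
  by rewrite mulrS addrCA; exact: root_space_lie.
have inj : injective (fun n => c + b *+ n).
  have bn n : b *+ n.+1 != 0.
    by rewrite -scaler_nat scaler_eq0 negb_or charK.
  move=> n m /addrI; wlog le : n m / (n <= m)%N.
    by move=> H; case: (leqP n m) => [|/ltnW] le E; [exact: H|apply/esym/H].
  rewrite -(subnK le); case: (m - n)%N => // k /eqP.
  by rewrite mulrnDr eq_sym -subr_eq0 addrK (negPf (bn _)).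
have := @uniq_leq_size _ [seq c + b *+ n | n <- iota 0 (size s).+1] s.
rewrite map_inj_uniq // iota_uniq size_map size_iota ltnn => H.
by suff: false by []; apply: H => // z /mapP[n _ ->].
Qed.

(** The lowering computation, for [mu] zero as in a Heisenberg algebra or
    nonzero as in a rescaled sl_2: e f^(n+1) y = (sum_(j <= n) (la + j mu)) f^n y. *)
Lemma primitive_iter (e f hh y : g) (la mu : K) :
  lie e f = hh -> lie hh f = mu *: f -> lie hh y = la *: y -> lie e y = 0 ->
  y != 0 -> (forall n, n.+1%:R * la + 'C(n.+1, 2)%:R * mu != 0) ->
  forall n, iter n (lie f) y != 0.
Proof.
move=> ef hf hy ey y0 gam.
have hn n : lie hh (iter n (lie f) y) = (la + n%:R * mu) *: iter n (lie f) y.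
  elim: n => [|n IH] /=; first by rewrite mul0r addr0.
  rewrite lie_lie hf IH lieZl lieZr -scalerDl; congr (_ *: _).
  by rewrite -natr1; ring.
have en n : lie e (iter n.+1 (lie f) y) =
    (n.+1%:R * la + 'C(n.+1, 2)%:R * mu) *: iter n (lie f) y.
  elim: n => [|n IH] /=; first by rewrite lie_lie ef hy ey lie0r addr0 mul0r mul1r addr0.
  rewrite lie_lie ef -[lie f (iter n _ _)]/(iter n.+1 _ _) hn IH lieZr -scalerDl.
  congr (_ *: _); rewrite [in RHS]binS bin1 -(natr1 n.+1) natrD.
  by ring.
elim=> [|n IH] //; apply: contraTneq isT => E; have := en n.
rewrite E lie0r => /esym/eqP; rewrite scaler_eq0 (negPf IH) (negPf (gam n)) //.
Qed.

Hypothesis g_ss : semisimple g.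

Lemma central0 t : (forall x, lie t x = 0) -> t = 0.
Proof.
move=> tC; apply/eqP; rewrite -memv0 -(g_ss (U := <[t]>%VS)) ?memv_line //.
  by move=> x y /vlineP[k ->]; rewrite lieZr lieC tC oppr0 scaler0 mem0v.
exists 1%N => /=; apply/eqP; rewrite -subv0; apply: lie_prodv_sub => x y.
by move=> /vlineP[k ->] _; rewrite lieZl tC scaler0 mem0v.
Qed.

(** If b is isotropic, then e, f and t_b = [e, f] span a Heisenberg algebra in
    which t_b is central.  On top of an e-string through weight c the vectors
    f^n never vanish unless c(t_b) = 0; so t_b acts by zero on every weight
    space, is central in g, and vanishes by semisimplicity. *)
Lemma root_norm_neq0 b x : b != 0 -> x \in root_space b -> x != 0 ->
  wt b (form_sharp B b) != 0.
Proof.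
move=> b0 bx x0; apply/negP => /eqP bb; have /eqP := b0; apply.
have [y yb Bxy] := root_space_dual bx x0.
set hh := form_sharp B b in bb *.
have hhh : hh \in h := sharp_mem b.
suff: hh = 0.
  move=> h0; apply: wt_inj => t th; rewrite wt0 -sharpE // -/hh h0.
  exact: sym0l.
apply: central0; apply: weight_ind => [k u v u0 v0|c z cz].
  by rewrite lieDr lieZr u0 v0 scaler0 addr0.
case: (eqVneq z 0) => [->|z0]; first exact: lie0r.
rewrite (root_spaceP _ _ cz) //; case: (eqVneq (wt c hh) 0) => [->|cb0].
  by rewrite scale0r.
pose en n := iter n (lie x) z.
have en_root n : en n \in root_space (c + b *+ n).
  elim: n => [|n IH] /=; first by rewrite addr0.
  by rewrite mulrS addrCA; exact: root_space_lie.
(* en m is the top of the string through z in the direction b *)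
have [m em0 emin] : exists2 m, en m != 0 & en m.+1 = 0.
  have ex : exists n, en n == 0.
    by have [n /eqP ?] := root_string_finite b0 bx cz; exists n.
  case: (ex_minnP ex) => -[|m] /eqP em min; first by rewrite -[z]/(en 0%N) em eqxx in z0.
  by exists m => //; apply/negP => /min; rewrite ltnn.
have [|n fn0] := @root_string_finite (- b) (c + b *+ m) y (en m) _ yb (en_root m).
  by rewrite oppr_eq0.
have wtMn k : wt (b *+ k) hh = 0.
  by elim: k => [|k IH]; rewrite ?mulr0n ?wt0 // mulrS wtD bb IH addr0.
have /eqP[] : iter n (lie y) (en m) != 0; last exact: fn0.
apply: (@primitive_iter x y (B x y *: hh) (en m) (B x y * wt c hh) 0) => //.
- exact: lie_opp_roots.
- by rewrite lieZl (root_spaceP _ _ yb) // wtN bb oppr0 !scale0r scaler0.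
- by rewrite lieZl (root_spaceP _ _ (en_root m)) // wtD wtMn addr0 scalerA.
- by move=> k; rewrite mulr0 addr0 !mulf_neq0.
Qed.

(** The difference [w] of the two sides is orthogonal to [x], hence killed by
    [lie x]; but it has weight - b, negative for the sl_2 of [x] and [y], so
    the powers of [lie y] never kill it unless it is zero. *)
Lemma root_space_dim1 b x y z : b != 0 -> x \in root_space b ->
  y \in root_space (- b) -> B x y != 0 -> z \in root_space (- b) ->
  z = (B x z / B x y) *: y.
Proof.
move=> b0 bx yb Bxy zb; apply/eqP; rewrite -subr_eq0; apply/eqP.
set w := _ - _; have wb : w \in root_space (- b) by rewrite memvB ?memvZ.
apply: contrapT => /eqP w0.
have x0 : x != 0.
  by apply: contraNneq Bxy => ->; rewrite sym0l.
have bb := root_norm_neq0 b0 bx x0.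
have hhh := sharp_mem b.
have [|n fn0] := @root_string_finite (- b) (- b) y w _ yb wb.
  by rewrite oppr_eq0.
have /eqP[] : iter n (lie y) w != 0; last exact: fn0.
set hh := form_sharp B b in bb hhh.
apply: (@primitive_iter x y (B x y *: hh) w (- (B x y * wt b hh)) (- (B x y * wt b hh))) => //.
- exact: lie_opp_roots.
- by rewrite lieZl (root_spaceP _ _ yb) // wtN scalerA mulrN.
- by rewrite lieZl (root_spaceP _ _ wb) // wtN scalerA mulrN.
- by rewrite (lie_opp_roots bx wb) /w symDr symNr symZr mulfVK ?subrr ?scale0r //.
- by move=> k; rewrite -mulrDl -natrD addSn mulf_neq0 // oppr_eq0 mulf_neq0.
Qed.

End Weights.

(** * The subalgebra attached to a subdiagram *)

Section Levi.
Variables (K : fieldType) (g : lieAlgType K) (h : {vspace g}) (B : {symmetric g}).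
Variables (n : nat) (alpha : n.-tuple (dualv h)) (D : {set 'I_n}).
Implicit Types (x y z t w : g) (b c : dualv h).

Hypothesis charK : forall n, n.+1%:R != 0 :> K.
Hypothesis g_ss : semisimple g.
Hypothesis h_cartan : cartan_subalgebra h.
Hypothesis B_nondeg : nondegenerate (theta := idfun) B.
Hypothesis B_inv : form_invariant B.
Hypothesis alpha_simple : simple_roots alpha.

Local Notation gD := (sub_g alpha D).
Local Notation np := (sub_np alpha D).
Local Notation nm := (sub_nm alpha D).
Local Notation cD := (sub_c alpha D).
Local Notation al i := (tnth alpha i).
Local Notation nilr := (nil_root alpha D).

Hypothesis gD_nondeg :
  forall x, x \in gD -> (forall y, y \in gD -> B x y = 0) -> x = 0.

Lemma alpha_neq0 i : al i != 0.
Proof. by have [_ /(_ i)[]] := alpha_simple. Qed.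

Lemma root_ofP (U : {vspace g}) b :
  root_of U b <-> b != 0 /\ exists x, [/\ x \in U, x \in root_space b & x != 0].
Proof.
split=> [[b0 Ub]|[b0 [x [xU xb x0]]]]; split=> //.
  exists (vpick (U :&: root_space b)%VS); have := memv_pick (U :&: root_space b)%VS.
  by rewrite memv_cap vpick0 => /andP[].
by apply: contraNneq x0 => Ub; rewrite -memv0 -Ub memv_cap xU.
Qed.

Lemma alpha_comb_inj (c d : 'I_n -> nat) :
  \sum_i al i *+ c i = \sum_i al i *+ d i -> c =1 d.
Proof.
have [/basis_free/freeP fr _ _] := alpha_simple => E i.
have natr_inj (p q : nat) : p%:R = q%:R :> K -> p = q.
  wlog le : p q / (p <= q)%N.
    by move=> H; case: (leqP p q) => [|/ltnW] le e; [exact: H|apply/esym/H].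
  rewrite -(subnK le); case: (q - p)%N => // k /eqP.
  by rewrite natrD eq_sym -subr_eq0 addrK (negPf (charK _)).
apply: natr_inj; apply/eqP; rewrite -subr_eq0; apply/eqP.
apply: (fr (fun i => (c i)%:R - (d i)%:R)).
under eq_bigr do rewrite -tnth_nth scalerBl !scaler_nat.
by rewrite sumrB E subrr.
Qed.

Lemma nonnegD b c : nonneg_comb alpha b -> nonneg_comb alpha c ->
  nonneg_comb alpha (b + c).
Proof.
move=> [p ->] [q ->]; exists (fun i => (p i + q i)%N).
by rewrite -big_split; apply: eq_bigr => i _; rewrite mulrnDr.
Qed.

Lemma nonneg_alpha i : nonneg_comb alpha (al i).
Proof.
exists (fun j => (i == j) : nat); rewrite (bigD1 i) //= eqxx big1 ?addr0 // => j.
by rewrite eq_sym => /negPf ->.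
Qed.

Lemma nonneg_add0 b c : nonneg_comb alpha b -> nonneg_comb alpha c ->
  b + c = 0 -> b = 0.
Proof.
move=> [p ->] [q ->]; rewrite -big_split /= => E.
have /alpha_comb_inj pq : \sum_i al i *+ (p i + q i) = \sum_i al i *+ 0.
  by rewrite [RHS]big1 // -[RHS]E; apply: eq_bigr => i _; rewrite mulrnDr.
by rewrite big1 // => i _; have /eqP := pq i; rewrite addn_eq0 => /andP[/eqP-> _].
Qed.

Lemma nonneg_add_alpha b c i : nonneg_comb alpha b -> nonneg_comb alpha c ->
  b + c = al i -> b = 0 \/ b = al i.
Proof.
move=> [p ->] [q ->] E.
have /alpha_comb_inj pq : \sum_j al j *+ (p j + q j) = \sum_j al j *+ (i == j).
  rewrite [RHS](bigD1 i) //= eqxx [X in _ + X]big1 => [|j]; last first.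
    by rewrite eq_sym => /negPf ->.
  by rewrite addr0 -[RHS]E -big_split; apply: eq_bigr => j _; rewrite mulrnDr.
have pj j : j != i -> p j = 0%N.
  by move=> ji; have := pq j; rewrite eq_sym (negPf ji); case: (p j).
rewrite (bigD1 i) //= big1 => [|j ji]; last by rewrite pj.
have := pq i; rewrite eqxx addr0; case: (p i) => [|[|k]] //; [by left|by right].
Qed.

Lemma gD_lie x y : x \in gD -> y \in gD -> lie x y \in gD.
Proof. exact: lie_gen_lie. Qed.

Lemma gD_ind (P : g -> Prop) :
  (forall k x y, P x -> P y -> P (k *: x + y)) -> P 0 ->
  (forall i x, i \in D -> x \in root_space (al i) \/ x \in root_space (- al i) -> P x) ->
  (forall x y, x \in gD -> y \in gD -> P x -> P y -> P (lie x y)) ->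
  forall x, x \in gD -> P x.
Proof.
move=> Pl P0 Pa Plie; apply: lie_gen_ind => // x /memv_sumP[u uD ->].
have PD x' y : P x' -> P y -> P (x' + y) by rewrite -{2}[x']scale1r; exact: Pl.
apply: big_ind => // i iD; have /memv_addP[y yi [z zi ->]] := uD i iD.
by apply: PD; apply: (Pa i) => //; [left|right].
Qed.

Lemma gD_root i x : i \in D ->
  x \in root_space (al i) \/ x \in root_space (- al i) -> x \in gD.
Proof.
move=> iD xi; apply: (subvP (sub_lie_gen _)); apply: (subvP (sumv_sup i iD (subvv _))).
by case: xi => xi; apply: subvP xi; rewrite ?addvSl ?addvSr.
Qed.

Lemma gD_ad_cartan t x : t \in h -> x \in gD -> lie t x \in gD.
Proof.
move=> th xD; apply: (gD_ind (P := fun x => lie t x \in gD)) xD =>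
  [k {}x y xD yD||i {}x iD xi|{}x y xD yD txD tyD].
- by rewrite lieDr lieZr memvD ?memvZ.
- by rewrite lie0r mem0v.
- have xD := gD_root iD xi.
  by case: xi => /root_spaceP -> //; rewrite memvZ.
by rewrite lie_lie memvD //; apply: gD_lie.
Qed.

(** Orthogonal projection onto [gD]. *)
Lemma gD_split x : exists2 u, u \in gD & forall y, y \in gD -> B x y = B u y.
Proof.
pose F (y : subvs_of gD) : K^o := B x (vsval y).
have Fl : linear F by move=> k y z; rewrite /F vsval_lin symDr symZr.
exists (form_sharp B (linfun F)) => [|y yD]; first exact: form_sharp_mem.
by rewrite (form_sharpE gD_nondeg) // linfunE // /F vsprojK.
Qed.

(** As h preserves both [gD] and the form, the component in [gD] of a weight
    vector keeps its weight. *)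
Lemma gD_split_root b x : x \in root_space b ->
  exists2 u, u \in gD /\ u \in root_space b & forall y, y \in gD -> B x y = B u y.
Proof.
move=> bx; have [u uD xu] := gD_split x; exists u => //; split=> //.
apply/root_spaceP => t th; apply/eqP; rewrite -subr_eq0; apply/eqP/gD_nondeg.
  by rewrite memvB ?memvZ ?gD_ad_cartan.
move=> y yD; rewrite symDl symNl symZl (form_ad B_inv) -!xu ?gD_ad_cartan //.
by rewrite -(form_ad B_inv) (root_spaceP _ _ bx) // symZl subrr.
Qed.

Lemma gD_root_dual b x : x \in gD -> x \in root_space b -> x != 0 ->
  exists y, [/\ y \in gD, y \in root_space (- b) & B x y != 0].
Proof.
move=> xD xb x0; have [y yb Bxy] := root_space_dual h_cartan B_inv B_nondeg xb x0.
have [u [uD ub] yu] := gD_split_root yb; exists u; split => //.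
by rewrite symC -yu // symC.
Qed.

(** The form is nondegenerate on [gD] and pairs weight b with weight - b. *)
Lemma gD_root_opp b : root_of gD b -> root_of gD (- b).
Proof.
case/root_ofP => b0 [x [xD xb x0]]; have [y [yD yb Bxy]] := gD_root_dual xD xb x0.
apply/root_ofP; split; first by rewrite oppr_eq0.
by exists y; split=> //; apply: contraNneq Bxy => ->; rewrite sym0r.
Qed.

(** One nonzero vector suffices, as the root space is a line. *)
Lemma gD_root_sub b x : root_of gD b -> x \in root_space b -> x \in gD.
Proof.
case/root_ofP => b0 [z [zD zb z0]] xb; have [y [yD yb Bzy]] := gD_root_dual zD zb z0.
rewrite (root_space_dim1 h_cartan B_inv B_nondeg charK g_ss (b := - b) _ yb _ _ (z := x)
  (y := z)) ?opprK ?oppr_eq0 ?memvZ // symC //.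
Qed.

Lemma gD_ortho_root b x y : ~ root_of gD b -> b != 0 -> x \in root_space b ->
  y \in gD -> B x y = 0.
Proof.
move=> Nb b0 bx yD; have [u [uD ub] ->//] := gD_split_root bx.
case: (eqVneq u 0) => [->|u0]; first exact: sym0l.
by case: Nb; apply/root_ofP; split=> //; exists u.
Qed.

(** * The two nilradicals *)

Lemma root_finite : exists s : seq (dualv h), forall b, root_of {:g} b -> b \in s.
Proof.
have [s sP] := weights_finite h_cartan B_inv B_nondeg.
by exists s => b /root_ofP[_ [x [_ xb x0]]]; exact: sP xb x0.
Qed.

Lemma root_set_finite (A : set (dualv h)) :
  (forall b, A b -> root_of {:g} b) -> finite_set A.
Proof.
move=> Ar; have [s sP] := root_finite.
by apply: (sub_finite_set _ (finite_seq s)) => b /Ar /sP.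
Qed.

Lemma nil_finite : finite_set nilr.
Proof. by apply: root_set_finite => b [[]]. Qed.

Lemma np_ind (P : g -> Prop) :
  (forall k x y, P x -> P y -> P (k *: x + y)) -> P 0 ->
  (forall b x, nilr b -> x \in root_space b -> P x) -> forall x, x \in np -> P x.
Proof. by move=> Pl P0 Pn; apply: fsbig_addv_ind => //; exact: nil_finite. Qed.

Lemma nm_ind (P : g -> Prop) :
  (forall k x y, P x -> P y -> P (k *: x + y)) -> P 0 ->
  (forall b x, nilr b -> x \in root_space (- b) -> P x) -> forall x, x \in nm -> P x.
Proof. by move=> Pl P0 Pn; apply: fsbig_addv_ind => //; exact: nil_finite. Qed.

Lemma np_ortho y : (forall b x, nilr b -> x \in root_space b -> B x y = 0) ->
  forall x, x \in np -> B x y = 0.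
Proof.
move=> By; apply: np_ind => // [k x z x0 z0|]; last exact: sym0l.
by rewrite symDl symZl x0 z0 mulr0 addr0.
Qed.

Lemma nm_ortho y : (forall b x, nilr b -> x \in root_space (- b) -> B x y = 0) ->
  forall x, x \in nm -> B x y = 0.
Proof.
move=> By; apply: nm_ind => // [k x z x0 z0|]; last exact: sym0l.
by rewrite symDl symZl x0 z0 mulr0 addr0.
Qed.

Lemma np_root b x : nilr b -> x \in root_space b -> x \in np.
Proof. by move=> nb; apply: subvP; apply: fsbig_addv_sup nb; exact: nil_finite. Qed.

Lemma nm_root b x : nilr b -> x \in root_space (- b) -> x \in nm.
Proof.
by move=> nb; apply: subvP; apply: (fsbig_addv_sup (fun b => root_space (- b))) nb;
  exact: nil_finite.
Qed.

Lemma nil_neq0 b : nilr b -> b != 0.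
Proof. by case=> [[[]]]. Qed.

Lemma nil_nonneg b : nilr b -> nonneg_comb alpha b.
Proof. by case=> [[]]. Qed.

Lemma nil_opp b : nilr b -> ~ root_of gD (- b).
Proof. by case=> _ Nb /gD_root_opp; rewrite opprK. Qed.

Lemma nil_add_neq0 b c : nilr b -> nilr c -> b + c != 0.
Proof.
move=> nb nc; apply: contra (nil_neq0 nb) => /eqP.
by move/(nonneg_add0 (nil_nonneg nb) (nil_nonneg nc))/eqP.
Qed.

Lemma gD_alpha i : i \in D -> root_of gD (al i).
Proof.
move=> iD; have [_ /(_ i)/root_ofP[a0 [x [_ xa x0]]] _] := alpha_simple.
by apply/root_ofP; split=> //; exists x; split=> //; apply: gD_root iD _; left.
Qed.

(** Among the weights b + al i and b - al i, those that matter for the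
    stability of the nilradicals stay in [nilr].  Positivity: subtracting a
    simple root from a positive root other than itself leaves some positive
    coefficient.  Not a root of [gD]: otherwise the line of [w] would lie in
    [gD], while [w] is orthogonal to [gD]. *)
Lemma nil_shift b c i w : nilr b -> i \in D -> c = b + al i \/ c = b - al i ->
  w \in root_space c \/ w \in root_space (- c) -> w != 0 ->
  (forall y, y \in gD -> B w y = 0) -> nilr c.
Proof.
move=> nb iD cE wc w0 wD.
have bn := nil_nonneg nb; have an := nonneg_alpha i.
have c0 : c != 0.
  apply: contraPneq nb => c0 nb; case: cE => /esym; rewrite c0.
    by move/(nonneg_add0 bn an)/eqP; rewrite (negPf (nil_neq0 nb)).
  by move/eqP; rewrite subr_eq0 => /eqP bE; case: nb => _; rewrite bE; apply; exact: gD_alpha.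
have rc : root_of {:g} c.
  apply/root_ofP; split=> //; case: wc => wc; first by exists w; rewrite memvf.
  have [y yc Bwy] := root_space_dual h_cartan B_inv B_nondeg wc w0.
  exists y; rewrite memvf -[c]opprK; split => //.
  by apply: contraNneq Bwy => ->; rewrite sym0r.
have Dc : ~ root_of gD c.
  have wND : w \notin gD by apply: contra w0 => wD'; apply/eqP/gD_nondeg.
  move=> Dc; case/negP: wND; case: wc; first exact: gD_root_sub.
  by apply: gD_root_sub; exact: gD_root_opp.
split=> //; split=> //.
case: cE => cE; first by rewrite cE; exact: nonnegD.
have [_ _ /(_ c rc)[//|nc]] := alpha_simple.
have [|b0|bE] := @nonneg_add_alpha b (- c) i bn nc.
- by rewrite cE opprB addrC subrK.
- by move: (nil_neq0 nb); rewrite b0 eqxx.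
by case: nb => _; rewrite bE; case; exact: gD_alpha.
Qed.

Lemma gD_ortho_np x y : x \in np -> y \in gD -> B x y = 0.
Proof.
move=> xn yD; apply: np_ortho x xn => b x nb xb.
by apply: gD_ortho_root xb yD; [case: nb|exact: nil_neq0].
Qed.

Lemma gD_ortho_nm x y : x \in nm -> y \in gD -> B x y = 0.
Proof.
move=> xn yD; apply: nm_ortho x xn => b x nb xb.
by apply: gD_ortho_root xb yD; [exact: nil_opp|rewrite oppr_eq0 nil_neq0].
Qed.

Lemma ortho_lie x z : x \in gD -> (forall y, y \in gD -> B z y = 0) ->
  forall y, y \in gD -> B (lie x z) y = 0.
Proof. by move=> xD zD y yD; rewrite (form_ad B_inv) zD ?oppr0 ?gD_lie. Qed.

(** The elements that stabilise a subspace form a subalgebra, so generators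
    are enough. *)
Lemma gD_stable (U : {vspace g}) :
  (forall i x z, i \in D -> x \in root_space (al i) \/ x \in root_space (- al i) ->
     z \in U -> lie x z \in U) ->
  forall x z, x \in gD -> z \in U -> lie x z \in U.
Proof.
move=> Ustab x z xD; move: z.
apply: (gD_ind (P := fun x => forall z, z \in U -> lie x z \in U)) xD.
- by move=> k {}x y xU yU z zU; rewrite lieDl lieZl memvD ?memvZ ?xU ?yU.
- by move=> z _; rewrite lie0l mem0v.
- by move=> i {}x iD xi z; apply: Ustab xi.
move=> {}x y xD yD xU yU z zU.
have -> : lie (lie x y) z = lie x (lie y z) - lie y (lie x z) by rewrite lie_lie addrK.
by rewrite memvB ?xU ?yU // ?xU ?yU.
Qed.

Lemma gD_np x z : x \in gD -> z \in np -> lie x z \in np.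
Proof.
apply: gD_stable => i {}x {}z iD xi zn; have xD := gD_root iD xi.
apply: (np_ind (P := fun z => lie x z \in np)) zn => [k u w un wn||b u nb ub].
- by rewrite lieDr lieZr memvD ?memvZ.
- by rewrite lie0r mem0v.
case: (eqVneq (lie x u) 0) => [->|w0]; first exact: mem0v.
have wD := ortho_lie xD (fun y => gD_ortho_np (np_root nb ub) (y := y)).
case: xi => xi; have wc := root_space_lie xi ub; rewrite addrC in wc;
  apply: np_root (wc); apply: (nil_shift nb iD _ (or_introl wc)) => //; by [left|right].
Qed.

Lemma gD_nm x z : x \in gD -> z \in nm -> lie x z \in nm.
Proof.
apply: gD_stable => i {}x {}z iD xi zn; have xD := gD_root iD xi.
apply: (nm_ind (P := fun z => lie x z \in nm)) zn => [k u w un wn||b u nb ub].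
- by rewrite lieDr lieZr memvD ?memvZ.
- by rewrite lie0r mem0v.
case: (eqVneq (lie x u) 0) => [->|w0]; first exact: mem0v.
have wD := ortho_lie xD (fun y => gD_ortho_nm (nm_root nb ub) (y := y)).
case: xi => xi; have wc := root_space_lie xi ub.
  rewrite -opprB in wc; apply: nm_root (wc).
  by apply: (nil_shift nb iD _ (or_intror wc)) => //; right.
rewrite addrC -opprD in wc; apply: nm_root (wc).
by apply: (nil_shift nb iD _ (or_intror wc)) => //; left.
Qed.

(** * The centre of the Levi subalgebra and the decomposition *)

Lemma cDP x : reflect (x \in (gD + h)%VS /\ forall y, y \in (gD + h)%VS -> lie y x = 0)
  (x \in cD).
Proof.
rewrite /sub_c /lie_center /sub_l memv_cap.
apply: (iffP andP) => [[xU /bigcapv_seqP xC]|[xU xC]]; split=> //.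
  move=> y yU; rewrite (coord_vbasis yU) (linear_fun_sum (@lie_linearl _ _ _)).
  rewrite big1 // => i _; rewrite lieZl.
  have := xC (vbasis (gD + h)%VS)`_i; rewrite mem_nth ?size_tuple // memv_ker adE.
  by move=> /(_ isT)/eqP ->; rewrite scaler0.
by apply/bigcapv_seqP => y yU; rewrite memv_ker adE xC // vbasis_mem.
Qed.

Lemma cD_cartan x : x \in cD -> x \in h.
Proof.
case/cDP=> _ xC; have [_ hC _] := h_cartan; apply: hC => t th.
by apply: xC; apply: subvP th; exact: addvSr.
Qed.

Lemma cD_lie x y : x \in cD -> y \in gD -> lie y x = 0.
Proof. by case/cDP=> _ xC yD; apply: xC; apply: subvP yD; exact: addvSl. Qed.

Lemma cartan_root b t x : t \in h -> b != 0 -> x \in root_space b -> B x t = 0.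
Proof.
rewrite -{1}(root_space0 h_cartan) => t0 b0 xb; apply: (form_root_space B_inv _ xb t0).
by rewrite addr0.
Qed.

(** On generators this is orthogonality of h to the root spaces, and on
    brackets B([u, w], x) = B(u, [w, x]) = 0. *)
Lemma cD_ortho x y : x \in cD -> y \in gD -> B y x = 0.
Proof.
move=> xc; apply: (gD_ind (P := fun y => B y x = 0)) => [k u w u0 w0||i u iD ui|u w uD wD u0 w0].
- by rewrite symDl symZl u0 w0 mulr0 addr0.
- exact: sym0l.
- by case: ui; apply: cartan_root; rewrite ?oppr_eq0 ?alpha_neq0 ?cD_cartan.
by rewrite B_inv cD_lie // sym0r.
Qed.

(** For [y] in [gD] the bracket [lie x y] lies in [gD] and is orthogonal to it,
    hence is zero. *)
Lemma cD_mem x : x \in h -> (forall y, y \in gD -> B x y = 0) -> x \in cD.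
Proof.
move=> xh xD; apply/cDP; split; first by apply: subvP xh; exact: addvSr.
move=> _ /memv_addP[y yD [t th ->]]; have [hC _ _] := h_cartan.
rewrite lieDl (hC t x) // addr0 lieC; apply/eqP; rewrite oppr_eq0; apply/eqP.
apply: gD_nondeg => [|z zD]; first exact: gD_ad_cartan.
by rewrite B_inv xD // gD_lie.
Qed.

Lemma np_ortho_cartan x t : x \in np -> t \in h -> B x t = 0.
Proof.
move=> xn th; apply: np_ortho x xn => b x nb; apply: cartan_root => //.
exact: nil_neq0.
Qed.

Lemma nm_ortho_cartan x t : x \in nm -> t \in h -> B x t = 0.
Proof.
move=> xn th; apply: nm_ortho x xn => b x nb; apply: cartan_root => //.
by rewrite oppr_eq0 nil_neq0.
Qed.

Lemma np_isotropic x y : x \in np -> y \in np -> B x y = 0.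
Proof.
move=> xn yn; apply: np_ortho x xn => b x nb xb; rewrite symC.
apply: np_ortho y yn => c y nc yc; apply: (form_root_space B_inv _ yc xb).
exact: nil_add_neq0.
Qed.

Lemma nm_isotropic x y : x \in nm -> y \in nm -> B x y = 0.
Proof.
move=> xn yn; apply: nm_ortho x xn => b x nb xb; rewrite symC.
apply: nm_ortho y yn => c y nc yc; apply: (form_root_space B_inv _ yc xb).
by rewrite -opprD oppr_eq0 nil_add_neq0.
Qed.

(** Every root space lies in one of the first three summands; a vector of h
    differs from its component in [gD] by a vector of h orthogonal to [gD]. *)
Lemma levi_full x : exists p m d k : g,
  [/\ p \in np, m \in nm, d \in gD, k \in cD & x = p + m + d + k].
Proof.
suff: x \in (np + nm + gD + cD)%VS.
  case/memv_addP=> _ /memv_addP[_ /memv_addP[p pn [m mn ->]] [d dD ->]] [k kc ->].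
  by exists p, m, d, k.
set W := (_ + cD)%VS.
have [Wp Wm Wd Wc] : [/\ np <= W, nm <= W, gD <= W & cD <= W]%VS.
  rewrite /W; split; last exact: addvSr.
  - by apply: subv_trans (addvSl _ _); apply: subv_trans (addvSl _ _); exact: addvSl.
  - by apply: subv_trans (addvSl _ _); apply: subv_trans (addvSl _ _); exact: addvSr.
  by apply: subv_trans (addvSl _ _); exact: addvSr.
apply: (weight_ind h_cartan (P := fun x => x \in W)) x => [k x y xW yW|b x xb].
  by rewrite memvD ?memvZ.
case: (eqVneq x 0) => [->|x0]; first exact: mem0v.
case: (eqVneq b 0) => [b0|b0].
  have [u [uD ub] xu] := gD_split_root xb; rewrite -(subrK u x) memvD //.
    apply: (subvP Wc); apply: cD_mem => [|y yD]; last by rewrite symDl symNl xu ?subrr.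
    by rewrite -(root_space0 h_cartan) -b0 memvB.
  exact: (subvP Wd).
have rb : root_of {:g} b by apply/root_ofP; split=> //; exists x; rewrite memvf.
case: (pselect (root_of gD b)) => [Db|Db].
  by apply: (subvP Wd); exact: gD_root_sub xb.
have [_ _ /(_ b rb)[pb|pb]] := alpha_simple.
  by apply: (subvP Wp); exact: np_root xb.
apply: (subvP Wm); apply: (@nm_root (- b)); last by rewrite opprK.
split; last by move/gD_root_opp; rewrite opprK.
split=> //; apply/root_ofP; split; first by rewrite oppr_eq0.
have [y yb Bxy] := root_space_dual h_cartan B_inv B_nondeg xb x0.
exists y; rewrite memvf; split => //.
by apply: contraNneq Bxy => ->; rewrite sym0r.
Qed.

Lemma levi_ortho p m d k p' m' d' k' :
  p \in np -> m \in nm -> d \in gD -> k \in cD ->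
  p' \in np -> m' \in nm -> d' \in gD -> k' \in cD ->
  B (p + m + d + k) (p' + m' + d' + k') = B p m' + B m p' + B d d' + B k k'.
Proof.
move=> pn mn dD kc pn' mn' dD' kc'; rewrite !symDl !symDr.
rewrite (np_isotropic pn pn') (nm_isotropic mn mn').
rewrite (gD_ortho_np pn dD') (gD_ortho_nm mn dD') (np_ortho_cartan pn (cD_cartan kc')).
rewrite (nm_ortho_cartan mn (cD_cartan kc')) (cD_ortho kc' dD).
rewrite [B d p']symC [B d m']symC [B k p']symC [B k m']symC [B k d']symC.
rewrite (gD_ortho_np pn' dD) (gD_ortho_nm mn' dD) (np_ortho_cartan pn' (cD_cartan kc)).
rewrite (nm_ortho_cartan mn' (cD_cartan kc)) (cD_ortho kc dD').
by rewrite !addr0 !add0r.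
Qed.

(** The form pairs the two nilradicals with each other, and each of [gD] and
    [cD] with itself; so each component is determined by the pairings of the
    sum with one summand. *)
Lemma levi_direct p m d k : p \in np -> m \in nm -> d \in gD -> k \in cD ->
  p + m + d + k = 0 -> [/\ p = 0, m = 0, d = 0 & k = 0].
Proof.
move=> pn mn dD kc E.
have E0 y : B (p + m + d + k) y = 0 by rewrite E sym0l.
have comp u v w x : u \in np -> v \in nm -> w \in gD -> x \in cD ->
    [/\ B p v = 0, B m u = 0, B d w = 0 & B k x = 0].
  move=> un vn wD xc; have O := levi_ortho pn mn dD kc.
  have := O _ _ _ _ un (mem0v _) (mem0v _) (mem0v _).
  have := O _ _ _ _ (mem0v _) vn (mem0v _) (mem0v _).
  have := O _ _ _ _ (mem0v _) (mem0v _) wD (mem0v _).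
  have := O _ _ _ _ (mem0v _) (mem0v _) (mem0v _) xc.
  by rewrite !E0 !sym0r !addr0 !add0r => -> -> -> ->.
have O1 := levi_ortho pn (mem0v _) (mem0v _) (mem0v _).
have O2 := levi_ortho (mem0v _) mn (mem0v _) (mem0v _).
have O3 := levi_ortho (mem0v _) (mem0v _) dD (mem0v _).
have O4 := levi_ortho (mem0v _) (mem0v _) (mem0v _) kc.
split; apply: (form_eq0 B_nondeg) => y; have [u [v [w [x [un vn wD xc ->]]]]] := levi_full y;
  have [c1 c2 c3 c4] := comp _ _ _ _ un vn wD xc.
- by have := O1 _ _ _ _ un vn wD xc; rewrite !sym0l !addr0 c1.
- by have := O2 _ _ _ _ un vn wD xc; rewrite !sym0l !addr0 !add0r c2.
- by have := O3 _ _ _ _ un vn wD xc; rewrite !sym0l !addr0 !add0r c3.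
- by have := O4 _ _ _ _ un vn wD xc; rewrite !sym0l !addr0 !add0r c4.
Qed.

Lemma projE p m d k : p \in np -> m \in nm -> d \in gD -> k \in cD ->
  [/\ proj_np alpha D (p + m + d + k) = p, proj_nm alpha D (p + m + d + k) = m,
      proj_g alpha D (p + m + d + k) = d & proj_c alpha D (p + m + d + k) = k].
Proof.
have cap (U W : {vspace g}) : (forall x, x \in U -> x \in W -> x = 0) -> (U :&: W = 0)%VS.
  move=> UW; apply/eqP; rewrite -subv0; apply/subvP => x.
  by rewrite memv_cap memv0 => /andP[xU xW]; apply/eqP/UW.
have pi0 (U W : {vspace g}) x u w : (forall x, x \in U -> x \in W -> x = 0) ->
    u \in U -> w \in W -> u + w = x -> daddv_pi U W x = u.
  by move=> /cap UW uU wW <-; exact: daddv_piE.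
have sum3 (U V W : {vspace g}) x : x \in (U + V + W)%VS ->
    exists u v w, [/\ u \in U, v \in V, w \in W & x = u + v + w].
  by move=> /memv_addP[_ /memv_addP[u uU [v vV ->]] [w wW ->]]; exists u, v, w.
have neg0 x : - x = 0 -> x = 0 by move/eqP; rewrite oppr_eq0 => /eqP.
move=> pn mn dD kc; split.
- apply: (pi0 _ _ _ _ (m + d + k)) pn _ _; rewrite ?memv_add ?addrA // => x xU.
  case/sum3=> u [v [w [uU vV wW E]]].
  have [||/neg0 //] := levi_direct (p := - x) _ uU vV wW; first by rewrite memvN.
  by rewrite E -!addrA addNr.
- apply: (pi0 _ _ _ _ (p + d + k)) mn _ _; rewrite ?memv_add //.
    move=> x xU /sum3[u [v [w [uU vV wW E]]]].
    have [||_ /neg0] := levi_direct (m := - x) uU _ vV wW; rewrite ?memvN //.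
    by rewrite [u - x + v]addrAC [LHS]addrAC E subrr.
  by rewrite addrA [m + (p + d)]addrA [m + p]addrC.
- apply: (pi0 _ _ _ _ (p + m + k)) dD _ _; rewrite ?memv_add //.
    move=> x xU /sum3[u [v [w [uU vV wW E]]]].
    have [||_ _ /neg0] := levi_direct (d := - x) uU vV _ wW; rewrite ?memvN //.
    by rewrite [LHS]addrAC E subrr.
  by rewrite addrA [d + _]addrC.
apply: (pi0 _ _ _ _ (p + m + d)) kc _ _; rewrite ?memv_add //.
  move=> x xU /sum3[u [v [w [uU vV wW E]]]].
  have [||_ _ _ /neg0] := levi_direct (k := - x) uU vV wW _; rewrite ?memvN //.
  by rewrite E subrr.
by rewrite addrC.
Qed.

(** * The dual bracket *)

(** The identity of the introduction, paired with [X]; the projection P_- of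
    that identity appears here as its adjoint P_+ applied to [X]. *)
Lemma dual_lie_form X y z :
  B X (lie y (proj_np alpha D z - proj_nm alpha D z) +
       lie (proj_np alpha D y - proj_nm alpha D y) z) =
  2 * B X (dual_lie alpha D y z) +
  B (lie (proj_g alpha D y) (X + 2 *: proj_np alpha D X)) z -
  B (lie (proj_g alpha D z) (X + 2 *: proj_np alpha D X)) y.
Proof.
rewrite /dual_lie.
have [Xp [Xm [Xd [Xk [Xpn Xmn XdD Xkc XE]]]]] := levi_full X.
have [p [m [d [k [pn mn dD kc yE]]]]] := levi_full y.
have [p' [m' [d' [k' [pn' mn' dD' kc' zE]]]]] := levi_full z.
have [-> -> -> ->] : [/\ proj_np alpha D y = p, proj_nm alpha D y = m,
   proj_g alpha D y = d & proj_c alpha D y = k] by rewrite yE; exact: projE.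
have [-> -> -> ->] : [/\ proj_np alpha D z = p', proj_nm alpha D z = m',
   proj_g alpha D z = d' & proj_c alpha D z = k'] by rewrite zE; exact: projE.
have -> : proj_np alpha D X = Xp by rewrite XE; have [] := projE Xpn Xmn XdD Xkc.
have BXp q r s t : q \in np -> r \in nm -> s \in gD -> t \in cD ->
    B Xp (q + r + s + t) = B X r.
  move=> qn rn sD tc.
  have := levi_ortho Xpn (mem0v _) (mem0v _) (mem0v _) qn rn sD tc.
  have := levi_ortho Xpn Xmn XdD Xkc (mem0v _) rn (mem0v _) (mem0v _).
  by rewrite -XE !sym0l !sym0r !addr0 !add0r => -> ->.
(* the factor 3 is the value of 1 + 2 P_- on the component in nm *)
have lieW r q s t u : r \in gD -> q \in np -> s \in nm -> t \in gD -> u \in cD ->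
    B (lie r (X + 2 *: Xp)) (q + s + t + u) =
    - (B X (lie r q) + 3%:R * B X (lie r s) + B X (lie r t)).
  move=> rD qn sn tD uc; rewrite (form_ad B_inv) symDl symZl !lieDr (cD_lie uc rD).
  rewrite BXp ?gD_np ?gD_nm ?gD_lie ?mem0v // !symDr sym0r; ring.
rewrite yE zE !lieW //.
rewrite !(lieDl, lieDr, lieNl, lieNr, symDr, symNr, symZr).
rewrite [lie d' p]lieC [lie d' m]lieC [lie d' d]lieC !symNr.
by field; exact: (charK 1).
Qed.

(** * The r-matrix *)

Variables (e f : dualv h -> g).
Hypothesis efP : forall b, pos_root alpha {:g} b ->
  [/\ e b \in root_space b, f b \in root_space (- b) & lie (e b) (f b) = coroot B b].

(** By [lie_opp_roots] the coroot [e, f] equals B(e, f) times the vector of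
    which it is 2 / (b, b) times, and that vector is nonzero. *)
Lemma form_ef b : pos_root alpha {:g} b -> dual_form B b b / 2 * B (e b) (f b) = 1.
Proof.
move=> pb; have [eb fb lef] := efP pb.
have [[/root_ofP[b0 [x [_ xb x0]]] _] n2] := (pb, charK 1).
have bb := root_norm_neq0 h_cartan B_inv B_nondeg charK g_ss b0 xb x0.
have := lie_opp_roots h_cartan B_inv B_nondeg eb fb; rewrite lef /coroot => /eqP.
rewrite -subr_eq0 -scalerBl scaler_eq0 subr_eq0 => /orP[/eqP <-|/eqP t0].
  by rewrite (dual_formE h_cartan B_inv B_nondeg); field; rewrite n2 bb.
by move: bb; rewrite -(dual_formE h_cartan B_inv B_nondeg) /dual_form t0 sym0l eqxx.
Qed.

Local Notation nils := (finmap.enum_fset (fset_set nilr)).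

Lemma mem_nils b : b \in nils -> nilr b.
Proof. by rewrite (in_fset_set nil_finite) => /set_mem. Qed.

(** The roots of [gD] cancel; the enumeration of [nilr] turns the remaining
    sum over a set into a sum over a list. *)
Lemma standard_rB :
  standard_r B (pos_root alpha {:g}) e f - standard_r B (pos_root alpha gD) e f =
  \sum_(b <- nils) (dual_form B b b / 2) *: (ext1 (e b) * ext1 (f b)).
Proof.
have sub b : root_of gD b -> root_of {:g} b.
  by case/root_ofP=> b0 [x [_ xb x0]]; apply/root_ofP; split=> //; exists x; rewrite memvf.
rewrite /standard_r (fsbigID (pos_root alpha gD)) /=; last first.
  by apply: root_set_finite => b [].
have -> : (pos_root alpha {:g} `&` pos_root alpha gD)%classic = pos_root alpha gD.
  by apply/seteqP; split=> b [] // /[dup] /sub.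
have -> : (pos_root alpha {:g} `&` ~` pos_root alpha gD)%classic = nilr.
  apply/seteqP; split=> b [pb Nb]; split=> // Db; first by apply: Nb; split=> //; case: pb.
  by case: Db => /Nb.
by rewrite addrAC subrr add0r fsbig_finite //; exact: nil_finite.
Qed.

(** Stated for a relabelling [s] of the roots so that it applies both to
    positive roots, with s = id, and to negative ones, with s = -%R. *)
Lemma sum_nils_root (s : dualv h -> dualv h) (p q : dualv h -> g) :
  injective s ->
  (forall b, nilr b -> [/\ s b != 0, p b \in root_space (s b),
     q b \in root_space (- s b) & dual_form B b b / 2 * B (q b) (p b) = 1]) ->
  forall b u, nilr b -> u \in root_space (s b) ->
  \sum_(c <- nils) (dual_form B c c / 2 * B (q c) u) *: p c = u.
Proof.
move=> s_inj pq b u nb ub.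
rewrite (bigD1_seq b) ?finmap.fset_uniq /= ?(in_fset_set nil_finite) ?mem_set //.
rewrite big_seq_cond big1 ?addr0 => [|c /andP[/mem_nils nc cb]]; last first.
  have [_ _ qc _] := pq c nc; rewrite (form_root_space B_inv _ qc ub) ?mulr0 ?scale0r //.
  by rewrite addrC subr_eq0 eq_sym (inj_eq s_inj).
have [sb0 pb qb qp] := pq b nb.
have Bqp : B (q b) (p b) != 0.
  by apply: contra_eq_neq qp => ->; rewrite mulr0 eq_sym oner_neq0.
rewrite [in RHS](root_space_dim1 h_cartan B_inv B_nondeg charK g_ss (b := - s b) _ qb _ Bqp
  (z := u)) ?opprK ?oppr_eq0 //; congr (_ *: _).
by apply: (mulIf Bqp); rewrite mulfVK // mulrAC qp mul1r.
Qed.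

Lemma sum_nils_linear (p q : dualv h -> g) :
  linear (fun u => \sum_(c <- nils) (dual_form B c c / 2 * B (q c) u) *: p c).
Proof.
move=> a u w; rewrite scaler_sumr -big_split; apply: eq_bigr => b _ /=.
by rewrite symDr symZr scalerA -scalerDl; congr (_ *: _); ring.
Qed.

Lemma sum_nils_np z :
  \sum_(b <- nils) (dual_form B b b / 2 * B (f b) z) *: e b = proj_np alpha D z.
Proof.
have [p [m [d [k [pn mn dD kc ->]]]]] := levi_full z.
have [-> _ _ _] := projE pn mn dD kc.
have fn b : nilr b -> f b \in nm by case=> pb Nb; have [_ fb _] := efP pb; exact: nm_root fb.
transitivity (\sum_(b <- nils) (dual_form B b b / 2 * B (f b) p) *: e b).
  apply: eq_big_seq => b /mem_nils/fn fb; rewrite !symDr (nm_isotropic fb mn).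
  by rewrite (gD_ortho_nm fb dD) (nm_ortho_cartan fb (cD_cartan kc)) !addr0.
have lin := sum_nils_linear e f.
apply: (np_ind (P := fun p =>
  \sum_(b <- nils) (dual_form B b b / 2 * B (f b) p) *: e b = p)) pn => [a u w u0 w0||b u].
- by rewrite lin u0 w0.
- exact: linear_fun0 lin.
apply: (sum_nils_root (s := id)) => // c nc; have [ec fc _] := efP nc.1.
by rewrite nil_neq0 // symC form_ef //; case: nc.
Qed.

Lemma sum_nils_nm z :
  \sum_(b <- nils) (dual_form B b b / 2 * B (e b) z) *: f b = proj_nm alpha D z.
Proof.
have [p [m [d [k [pn mn dD kc ->]]]]] := levi_full z.
have [_ -> _ _] := projE pn mn dD kc.
have en b : nilr b -> e b \in np by case=> pb Nb; have [eb _ _] := efP pb; exact: np_root eb.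
transitivity (\sum_(b <- nils) (dual_form B b b / 2 * B (e b) m) *: f b).
  apply: eq_big_seq => b /mem_nils/en eb; rewrite !symDr (np_isotropic eb pn).
  by rewrite (gD_ortho_np eb dD) (np_ortho_cartan eb (cD_cartan kc)) !addr0 add0r.
have lin := sum_nils_linear f e.
apply: (nm_ind (P := fun m =>
  \sum_(b <- nils) (dual_form B b b / 2 * B (e b) m) *: f b = m)) mn => [a u w u0 w0||b u].
- by rewrite lin u0 w0.
- exact: linear_fun0 lin.
apply: (sum_nils_root (s := -%R)) => [|c nc]; first exact: oppr_inj.
have [ec fc _] := efP nc.1.
by rewrite opprK oppr_eq0 nil_neq0 // form_ef //; case: nc.
Qed.

(** * Comparison in degree one *)

Variables (r : nat) (v v' : r.-tuple g).
Hypothesis v'_basis : basis_of gD v'.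
Hypothesis v_mem : forall i, tnth v i \in gD.
Hypothesis vv' : forall i j, B (tnth v i) (tnth v' j) = (i == j)%:R.

Lemma sum_dual_basis y : \sum_(i < r) B (tnth v i) y *: tnth v' i = proj_g alpha D y.
Proof.
have [p [m [d [k [pn mn dD kc ->]]]]] := levi_full y.
have [_ _ -> _] := projE pn mn dD kc.
rewrite [in RHS](coord_basis v'_basis dD); apply: eq_bigr => i _.
rewrite -tnth_nth (coord_dual_basis i v'_basis vv' dD) !symDr.
rewrite [B _ p]symC [B _ m]symC (gD_ortho_np pn (v_mem i)) (gD_ortho_nm mn (v_mem i)).
by rewrite (cD_ortho kc (v_mem i)) addr0 !add0r.
Qed.

(** All three terms are written as [bivector]s, so only the pairings with
    y /\ z have to be compared; the two sums over roots become the
    projections and the sum over dual bases becomes the component in [gD]. *)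
Lemma standard_r_degree1 X :
  \sum_(b <- nils) (dual_form B b b / 2) *:
    (ext1 (lie (e b) X) * ext1 (f b) - ext1 (lie (f b) X) * ext1 (e b)) =
  2 *: cobracket B (dual_lie alpha D) X +
  \sum_(i < r) ext1 (tnth v i) * ext1 (lie (tnth v' i) (X + 2 *: proj_np alpha D X)).
Proof.
set W := X + _.
pose c1 b y z := B (e b) (lie X y) * B (f b) z - B (e b) (lie X z) * B (f b) y
   - (B (f b) (lie X y) * B (e b) z - B (f b) (lie X z) * B (e b) y).
have -> : \sum_(b <- nils) (dual_form B b b / 2) *:
    (ext1 (lie (e b) X) * ext1 (f b) - ext1 (lie (f b) X) * ext1 (e b)) =
    \sum_(b <- nils) (dual_form B b b / 2) *: bivector B (c1 b).
  apply: eq_bigr => b _; congr (_ *: _).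
  rewrite !(wedge2_expand B_nondeg) addrC -scaleN1r bivectorD; apply: bivector_eq => y z.
  by rewrite /c1 !B_inv; ring.
pose c2 i y z := B (tnth v i) y * B (lie (tnth v' i) W) z
   - B (tnth v i) z * B (lie (tnth v' i) W) y.
have -> : \sum_(i < r) ext1 (tnth v i) * ext1 (lie (tnth v' i) W) =
    \sum_(i < r) 1 *: bivector B (c2 i).
  by apply: eq_bigr => i _; rewrite (wedge2_expand B_nondeg) scale1r.
rewrite !bivector_sum.
have -> : cobracket B (dual_lie alpha D) X = bivector B (fun y z => B X (dual_lie alpha D y z)).
  by [].
rewrite bivectorD; apply: bivector_eq => y z.
transitivity (2 * B X (dual_lie alpha D y z) +
  B (lie (proj_g alpha D y) W) z - B (lie (proj_g alpha D z) W) y); last first.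
  rewrite -addrA; congr (_ + _).
  rewrite -!sum_dual_basis !(linear_fun_sum (@lie_linearl _ _ _)).
  rewrite !(linear_fun_sum (form_linearl _ _)) -sumrB; apply: eq_bigr => i _.
  by rewrite mul1r /c2 !lieZl !symZl.
rewrite -dual_lie_form.
have ring_np u w : \sum_(b <- nils) dual_form B b b / 2 * (B (e b) u * B (f b) w) =
    B u (proj_np alpha D w).
  rewrite -sum_nils_np (linear_fun_sum (form_linearr _ _)); apply: eq_bigr => b _.
  by rewrite symZr [B u _]symC; ring.
have ring_nm u w : \sum_(b <- nils) dual_form B b b / 2 * (B (f b) u * B (e b) w) =
    B u (proj_nm alpha D w).
  rewrite -sum_nils_nm (linear_fun_sum (form_linearr _ _)); apply: eq_bigr => b _.
  by rewrite symZr [B u _]symC; ring.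
rewrite /c1; under eq_bigr do rewrite !mulrBr.
rewrite !sumrB !ring_np !ring_nm !B_inv lieDr lieNr lieDl lieNl !symDr !symNr.
by rewrite [lie z _]lieC [lie z (proj_nm _ _ _)]lieC !symNr; ring.
Qed.

Lemma schouten_standard_r (x : extalg g) :
  schouten (standard_r B (pos_root alpha {:g}) e f - standard_r B (pos_root alpha gD) e f) x =
  2 *: ce_diff alpha D B x +
  \sum_(i < r) ext1 (tnth v i) *
    ext_lift (fun y => lie (tnth v' i) (y + 2 *: proj_np alpha D y)) x.
Proof.
rewrite standard_rB (linear_fun_sum (@schouten_linearl _ _ x)).
under eq_bigr do rewrite (linear_funZ (@schouten_linearl _ _ x)) schouten_mul2.
under [X in _ = _ + X]eq_bigr do rewrite ext1_mul_lift -[ext_der _ _]scale1r.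
rewrite /ce_diff ext_derZ !ext_der_sum ext_derD; apply: ext_der_eq => X.
rewrite standard_r_degree1; congr (_ + _); apply: eq_bigr => i _; exact/esym/scale1r.
Qed.

End Levi.

Theorem theorem4p4 (R : realType) (g : lieAlgType R[i]) (h : {vspace g})
  (n : nat) (alpha : n.-tuple (dualv h)) (D : {set 'I_n})
  (B : {symmetric g}) (e f : dualv h -> g)
  (m : nat) (v v' : m.-tuple g) :
  semisimple g ->
  cartan_subalgebra h ->
  simple_roots alpha ->
  nondegenerate (theta := idfun) B ->
  form_invariant B ->
  (forall b, pos_root alpha {:g} b ->
     [/\ e b \in root_space b, f b \in root_space (- b) &
         lie (e b) (f b) = coroot B b]) ->
  basis_of (sub_g alpha D) v ->
  basis_of (sub_g alpha D) v' ->
  (forall i j, B (tnth v i) (tnth v' j) = (i == j)%:R) ->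
  forall x : extalg g,
    schouten (standard_r B (pos_root alpha {:g}) e f -
              standard_r B (pos_root alpha (sub_g alpha D)) e f) x =
    2 *: ce_diff alpha D B x +
    \sum_(i < m) ext1 (tnth v i) *
      ext_lift (fun y => lie (tnth v' i) (y + 2 *: proj_np alpha D y)) x.
Proof.
move=> ss cartan simple nondeg inv ef vb v'b vv' x.
have charK k : k.+1%:R != 0 :> R[i] by rewrite Num.Theory.pnatr_eq0.
have v_mem i : tnth v i \in sub_g alpha D by rewrite (basis_mem vb) ?mem_tnth.
apply: (schouten_standard_r charK ss cartan nondeg inv simple _ ef v'b v_mem vv') => {}x xD Bx.
rewrite (coord_basis v'b xD) big1 // => i _.
by rewrite (coord_dual_basis i v'b vv' xD) symC Bx ?scale0r.
Qed.
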